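(* Let $d\geq 1$ and let $\mathscr{F}\subseteq[0,1]^d$ be a non-empty closed set having every portion of positive cone width. Let $\mathscr{A}\subseteq(0,1)^d$ be an analytic set such that $\mathscr{A}\cap\mathscr{F}$ is relatively residual in $\mathscr{F}$. Then there exist a $1$-Lipschitz curve $\gamma\colon[0,1]\to(0,1)^d$ and sets $E\subseteq F\subseteq[0,1]$ such that: (i) $F$ is non-empty, closed and has every portion of positive measure; (ii) $E$ is residual in $F$; (iii) $\gamma$ is differentiable at every $t\in E$ with $\|\gamma'(t)\|=1$; (iv) for every $t\in E$, $\lim_{\delta\to 0}\operatorname{osc}(\gamma',[t-\delta,t+\delta])=0$; (v) $\gamma(E)\subseteq\mathscr{A}$.
   Context: A curve (Lipschitz curve) is a Lipschitz map $\gamma\colon I\to\mathbb{R}^d$, $I$ a closed interval, whose derivative is bounded away from zero in norm almost everywhere; ''$1$-Lipschitz'' means Lipschitz constant at most $1$. A set $\mathscr{F}\subseteq\mathbb{R}^d$ has every portion of positive cone width if for every open $U\subseteq\mathbb{R}^d$ with $U\cap\mathscr{F}\neq\emptyset$ there is a $C^1$-smooth curve $\nu_U\colon[0,1]\to\mathbb{R}^d$ with nowhere zero derivative such that $\nu_U^{-1}(U\cap\mathscr{F})$ has positive Lebesgue measure. A set $F\subseteq\mathbb{R}$ has every portion of positive measure if for every open $U\subseteq\mathbb{R}$ with $U\cap F\neq\emptyset$, $U\cap F$ has positive Lebesgue measure. For an $L^\infty$ map $\phi\colon I\to\mathbb{R}^d$ and $U\subseteq I$, $\operatorname{osc}(\phi,U)=\operatorname{ess\,sup}\{\|\phi(s)-\phi(t)\|\colon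 s,t\in U\}$. *)

(* Defs.v *)
From HB Require Import structures.
From mathcomp Require Import all_boot all_order all_algebra.
From mathcomp Require Import all_classical all_reals all_analysis.
Set Implicit Arguments. Unset Strict Implicit. Unset Printing Implicit Defensive.
Import Order.TTheory GRing.Theory Num.Theory.
Import numFieldNormedType.Exports.
Local Open Scope classical_set_scope.
Local Open Scope ring_scope.

Section Defs.
Variable R : realType.

Definition enorm (d : nat) (x : 'rV[R]_d) : R :=
  Num.sqrt (\sum_(i < d) (x ord0 i) ^+ 2).

Definition unit_interval : set R := [set t | 0 <= t <= 1].
Definition closed_cube (d : nat) : set 'rV[R]_d :=
  [set x | forall i, 0 <= x ord0 i <= 1].
Definition open_cube (d : nat) : set 'rV[R]_d :=
  [set x | forall i, 0 < x ord0 i < 1].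

(* f has derivative v at t, relative to the set A (one-sided at endpoints of
   an interval). *)
Definition deriv_within (d : nat) (A : set R) (f : R -> 'rV[R]_d) (t : R)
    (v : 'rV[R]_d) : Prop :=
  A t /\ forall e : R, 0 < e -> exists2 del : R, 0 < del &
    forall s, A s -> 0 < `|s - t| < del ->
      enorm ((s - t)^-1 *: (f s - f t) - v) < e.

Definition cont_within (d : nat) (A : set R) (g : R -> 'rV[R]_d) (t : R) : Prop :=
  forall e : R, 0 < e -> exists2 del : R, 0 < del &
    forall s, A s -> `|s - t| < del -> enorm (g s - g t) < e.

Definition C1_regular_curve (d : nat) (nu : R -> 'rV[R]_d) : Prop :=
  exists nu' : R -> 'rV[R]_d,
    (forall s, unit_interval s -> deriv_within unit_interval nu s (nu' s)) /\
    (forall s, unit_interval s -> cont_within unit_interval nu' s) /\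
    (forall s, unit_interval s -> nu' s != 0).

Definition every_portion_pos_cone_width (d : nat) (F : set 'rV[R]_d) : Prop :=
  forall U : set 'rV[R]_d, open U -> U `&` F !=set0 ->
    exists nu : R -> 'rV[R]_d, C1_regular_curve nu /\
      (0 < (@lebesgue_measure R) [set s | unit_interval s /\ (U `&` F) (nu s)])%E.

Definition every_portion_pos_measure (F : set R) : Prop :=
  forall U : set R, open U -> U `&` F !=set0 ->
    (0 < (@lebesgue_measure R) (U `&` F))%E.

Definition residual_in (T : topologicalType) (X S : set T) : Prop :=
  exists G : nat -> set T,
    (forall n, exists2 O : set T, open O & G n = O `&` X) /\
    (forall n (O : set T), open O -> O `&` X !=set0 -> O `&` G n !=set0) /\
    \bigcap_n G n `<=` S.

(* Baire space nat^nat and continuity w.r.t. its product topology *)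
Definition baire_continuous (d : nat) (f : (nat -> nat) -> 'rV[R]_d) : Prop :=
  forall (x : nat -> nat) (e : R), 0 < e -> exists n : nat,
    forall y : nat -> nat, (forall k, (k < n)%N -> y k = x k) ->
      enorm (f y - f x) < e.

Definition analytic (d : nat) (A : set 'rV[R]_d) : Prop :=
  A = set0 \/ exists f : (nat -> nat) -> 'rV[R]_d,
    baire_continuous f /\ range f = A.

Definition lipschitz1_curve (d : nat) (gamma gamma' : R -> 'rV[R]_d) : Prop :=
  (forall s t, unit_interval s -> unit_interval t ->
     enorm (gamma s - gamma t) <= `|s - t|) /\
  exists2 c : R, 0 < c & exists N : set R, (@lebesgue_measure R).-negligible N /\
    forall s, unit_interval s -> ~ N s ->
      deriv_within unit_interval gamma s (gamma' s) /\ c <= enorm (gamma' s).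

(* essential oscillation of phi on U:
   ess sup { ||phi s - phi t|| : s, t in U }
   = inf over Lebesgue-null N of sup { ||phi s - phi t|| : s, t in U \ N } *)
Definition osc (d : nat) (phi : R -> 'rV[R]_d) (U : set R) : \bar R :=
  ereal_inf [set ereal_sup [set (enorm (phi s - phi t))%:E
                            | s in U `\` N & t in U `\` N]
            | N in (@lebesgue_measure R).-negligible].

End Defs.

(* Main.v *)
Require Import Defs.
From HB Require Import structures.
From mathcomp Require Import all_boot all_order all_algebra.
From mathcomp Require Import all_classical all_reals all_analysis.
From mathcomp Require Import measurable_realfun ring lra.
Set Implicit Arguments.
Unset Strict Implicit.
Unset Printing Implicit Defensive.
Import Order.TTheory GRing.Theory Num.Theory.
Import numFieldNormedType.Exports.
Local Open Scope classical_set_scope.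
Local Open Scope ring_scope.

(** By residuality [AA] contains the points of [FF] that lie in all of a decreasing
    sequence of open sets [O n], each of which is dense in [FF].

    Call a direction [u] [e]-hereditary on a portion [U] of [FF] if every smaller
    portion is met in positive measure by a regular curve whose tangents at the
    meeting points lie within [e] of [u].  By a finite net argument, a hereditary
    direction can be refined: some smaller portion carries an [e']-hereditary
    direction close to [u], for [e'] as small as desired.

    Start with a short piece of a curve that meets [FF] in positive measure, and
    keep splicing in tiny pieces: near a parameter [t] with [g t] in [FF], move
    the curve by a tiny displacement so that it follows, on a much smaller interval
    around [t], a curve that meets [FF `&` O n] in positive measure in a refined
    hereditary direction.  All slopes already prescribed on the intervals around
    [t] persist, because the displacement is negligible with respect to the length
    over which it is faded out.  If the pieces are small enough, then the limit
    curve is differentiable almost everywhere, a positive measure of each piece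
    survives, and the support [F] of all the surviving parameters has every portion
    of positive measure.  If moreover every surviving set receives new pieces
    densely, then generic points [t] of [F] lie in infinitely many pieces, with
    slopes confined to smaller and smaller balls around unit vectors; at such [t]
    the curve has a derivative of norm one and vanishing oscillation, and it lies
    in [FF] and in every [O n]. *)

(** * Euclidean norm and Lebesgue negligible sets *)

Section EuclideanNorm.
Context {R : realType} {d : nat}.
Implicit Types x y z : 'rV[R]_d.

Lemma enorm_ge0 x : 0 <= enorm x.
Proof. exact: sqrtr_ge0. Qed.

Lemma enorm_sqr x : enorm x ^+ 2 = \sum_(i < d) x ord0 i ^+ 2.
Proof. by rewrite sqr_sqrtr// sumr_ge0// => i _; rewrite sqr_ge0. Qed.

Lemma enorm0 : enorm (0 : 'rV[R]_d) = 0.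
Proof.
by rewrite /enorm big1 ?sqrtr0// => i _; rewrite mxE expr0n.
Qed.

Lemma enormZ (a : R) x : enorm (a *: x) = `|a| * enorm x.
Proof.
rewrite /enorm -sqrtr_sqr -sqrtrM ?sqr_ge0// mulr_sumr; congr Num.sqrt.
by apply: eq_bigr => i _; rewrite mxE exprMn.
Qed.

Lemma enormN x : enorm (- x) = enorm x.
Proof. by rewrite -scaleN1r enormZ normrN1 mul1r. Qed.

Lemma enormB x y : enorm (x - y) = enorm (y - x).
Proof. by rewrite -enormN opprB. Qed.

Lemma enorm_coord x i : `|x ord0 i| <= enorm x.
Proof.
rewrite -sqrtr_sqr ler_wsqrtr// (bigD1 i)//= lerDl sumr_ge0// => j _.
exact: sqr_ge0.
Qed.

Lemma enorm_eq0 x : enorm x = 0 -> x = 0.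
Proof.
move=> x0; apply/rowP => i; rewrite mxE; apply/eqP.
by rewrite -normr_le0 -x0 enorm_coord.
Qed.

(** Expand the nonnegative sum of the squares [(|y| x_i - |x| y_i)^2] and divide by [2 |x| |y|]. *)
Lemma cauchy_schwarz x y :
  \sum_(i < d) x ord0 i * y ord0 i <= enorm x * enorm y.
Proof.
have [/enorm_eq0 ->|x0] := eqVneq (enorm x) 0.
  by rewrite enorm0 mul0r big1// => i _; rewrite mxE mul0r.
have [/enorm_eq0 ->|y0] := eqVneq (enorm y) 0.
  by rewrite enorm0 mulr0 big1// => i _; rewrite mxE mulr0.
have xp : 0 < enorm x by rewrite lt_def x0 enorm_ge0.
have yp : 0 < enorm y by rewrite lt_def y0 enorm_ge0.
have : 0 <= \sum_(i < d) (enorm y * x ord0 i - enorm x * y ord0 i) ^+ 2.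
  by apply: sumr_ge0 => i _; exact: sqr_ge0.
rewrite (eq_bigr (fun i => enorm y ^+ 2 * x ord0 i ^+ 2
    + enorm x ^+ 2 * y ord0 i ^+ 2
    - (2 * enorm x * enorm y) * (x ord0 i * y ord0 i))); last first.
  by move=> i _; ring.
rewrite sumrB big_split/= -!mulr_sumr -!enorm_sqr subr_ge0.
rewrite (_ : enorm y ^+ 2 * _ + _ = (2 * enorm x * enorm y) * (enorm x * enorm y));
  last by ring.
by rewrite ler_pM2l// !mulr_gt0.
Qed.

Lemma enormD x y : enorm (x + y) <= enorm x + enorm y.
Proof.
rewrite -(@ler_pXn2r _ 2)// ?nnegrE ?addr_ge0 ?enorm_ge0//.
rewrite enorm_sqr.
under eq_bigr => i _ do rewrite mxE sqrrD.
rewrite !big_split/= -!enorm_sqr sqrrD lerD2r lerD2l.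
by rewrite -mulr2n lerMn2r/= cauchy_schwarz.
Qed.

Lemma enorm_trans y x z : enorm (x - z) <= enorm (x - y) + enorm (y - z).
Proof. by apply: le_trans (enormD _ _); rewrite addrA subrK. Qed.

Lemma enorm_dist x y : `|enorm x - enorm y| <= enorm (x - y).
Proof.
rewrite ler_norml; apply/andP; split.
  have := enorm_trans x y 0; rewrite !subr0 (enormB y x); lra.
have := enorm_trans y x 0; rewrite !subr0; lra.
Qed.

Lemma enorm_le_sum x : enorm x <= \sum_(i < d) `|x ord0 i|.
Proof.
rewrite -(@ler_pXn2r _ 2)// ?nnegrE ?sumr_ge0 ?enorm_ge0//.
rewrite enorm_sqr expr2 mulr_suml ler_sum// => i _.
rewrite -real_normK ?num_real// expr2 ler_wpM2l//.
by rewrite (bigD1 i)//= lerDl sumr_ge0.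
Qed.

Lemma enorm_le_const x (e : R) :
  (forall i, `|x ord0 i| <= e) -> enorm x <= d%:R * e.
Proof.
move=> xe; apply: le_trans (enorm_le_sum x) _.
apply: le_trans (ler_sum _ (fun i _ => xe i)) _.
by rewrite sumr_const card_ord mulr_natl.
Qed.

Lemma enorm_lt_ball x y (e : R) : 0 < e -> ball x e y ->
  enorm (y - x) <= d%:R * e.
Proof.
move=> e0 [_ xy]; apply: enorm_le_const => i; rewrite !mxE.
by have /ltW := xy ord0 i; rewrite distrC.
Qed.

Lemma ball_enorm x y (e : R) : enorm (y - x) < e -> ball x e y.
Proof.
move=> xy; split; first exact: le_lt_trans (enorm_ge0 _) xy.
move=> i j; rewrite (ord1 i) /ball/= distrC.
by apply: le_lt_trans xy; have := enorm_coord (y - x) j; rewrite !mxE.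
Qed.

Lemma open_enorm (U : set 'rV[R]_d) x : open U -> U x ->
  exists2 e : R, 0 < e & forall y, enorm (y - x) < e -> U y.
Proof.
move=> oU Ux; have /nbhs_ballP[e /= e0 eU] := open_nbhs_nbhs (conj oU Ux).
by exists e => // y /ball_enorm; exact: eU.
Qed.

Lemma enorm_open (U : set 'rV[R]_d) :
  (forall x, U x -> exists2 e : R, 0 < e & forall y, enorm (y - x) < e -> U y) ->
  open U.
Proof.
move=> UP; rewrite openE => x /UP[e e0 eU].
(* A sup-norm ball of radius [r] has Euclidean radius at most [d * r]; dividing by [d + 1] gives a
   strict inequality and covers [d = 0]. *)
apply/nbhs_ballP; exists (e / d.+1%:R) => /=; first by rewrite divr_gt0.
move=> y /enorm_lt_ball H; apply: eU; apply: le_lt_trans (H _) _.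
  by rewrite divr_gt0.
rewrite mulrCA gtr_pMr//; rewrite ltr_pdivrMr// mul1r ltr_nat//.
Qed.

Lemma open_eball x (e : R) : open [set y | enorm (y - x) < e].
Proof.
apply: enorm_open => y /= ye; exists (e - enorm (y - x)); first lra.
move=> z zy; have := enorm_trans y z x; lra.
Qed.

Lemma closed_enorm (F : set 'rV[R]_d) x : closed F ->
  (forall e : R, 0 < e -> exists2 y, F y & enorm (y - x) < e) -> F x.
Proof.
move=> cF Fx; apply: contrapT => nFx.
have [e e0 eF] := open_enorm (closed_openC cF) nFx.
by have [y Fy /eF] := Fx _ e0.
Qed.

(** In each coordinate the intervals [[x k - e k, x k + e k]] meet pairwise, so the supremum of
    their left ends lies in all of them. The factor [d] comes from passing back from coordinates to
    the norm. *)
Lemma enorm_cauchy (x : nat -> 'rV[R]_d) (e : nat -> R) :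
  (forall k l, enorm (x k - x l) <= e k + e l) ->
  exists y, forall k, enorm (x k - y) <= d%:R * e k.
Proof.
move=> xe.
pose A i := [set x k ord0 i - e k | k in [set: nat]].
have ub i l : ubound (A i) (x l ord0 i + e l).
  move=> _ [k _ <-]; have := enorm_coord (x k - x l) i; rewrite !mxE.
  have := xe k l; have := ler_norm (x k ord0 i - x l ord0 i); lra.
have supA i : has_sup (A i).
  by split; [exists (x 0%N ord0 i - e 0%N), 0%N|exists (x 0%N ord0 i + e 0%N)].
exists (\row_i sup (A i)) => k; apply: enorm_le_const => i; rewrite !mxE.
have : sup (A i) <= x k ord0 i + e k by apply: ge_sup => //; case: (supA i).
have : x k ord0 i - e k <= sup (A i).
  by apply: ub_le_sup; [case: (supA i)|exists k].
by rewrite ler_norml; lra.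
Qed.

End EuclideanNorm.

Section LebesgueNegligible.
Context {R : realType}.
Implicit Types A B : set R.
Local Notation mu := (@lebesgue_measure R).
Local Notation negl := (mu.-negligible).

(** [mu] is an outer measure on arbitrary sets, so positivity can be handled as non-negligibility
    without any measurability. *)
Lemma lebesgue_gt0P A : (0 < mu A)%E <-> ~ negl A.
Proof.
split=> [A0 /negligible_outer_measure nA|nA].
  by move: A0; rewrite (_ : mu A = 0%E)// ltxx.
rewrite lt0e; apply/andP; split.
  by apply/eqP => A0; apply/nA/negligible_outer_measure.
exact: (outer_measure_ge0 ((@wlength R idfun)^*)%mu).
Qed.

Lemma lebesgue_setU_le A B : (mu (A `|` B) <= mu A + mu B)%E.
Proof. exact: (outer_measureU2 ((@wlength R idfun)^*)%mu). Qed.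

Lemma lebesgue_sub_le A B : A `<=` B -> (mu A <= mu B)%E.
Proof. exact: (le_outer_measure ((@wlength R idfun)^*)%mu). Qed.

Lemma negl_lebesgue0 A : negl A <-> mu A = 0%E.
Proof. exact: negligible_outer_measure. Qed.

Lemma negl_point (a : R) : negl [set a].
Proof. by apply/negligibleP => //; exact: lebesgue_measure_set1. Qed.

Lemma posm_setD A B : ~ negl A -> negl B -> ~ negl (A `\` B).
Proof.
move=> nA nB nAB; apply: nA; apply: negligibleS (negligibleU nAB nB).
by move=> x Ax; have [Bx|Bx] := pselect (B x); [right|left].
Qed.

Lemma posm_nonempty A : ~ negl A -> A !=set0.
Proof.
move=> nA; apply/set0P/eqP => A0; apply: nA; rewrite A0.
exact: negligible_set0.
Qed.

Lemma negl_affine (k c : R) A : 0 < k -> negl A ->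
  negl [set s | A (k * s + c)].
Proof.
move=> k0 [B [mB B0 AB]].
pose f : R -> R := fun s => k * s + c.
have mf : measurable_fun [set: R] f.
  apply: continuous_measurable_fun => x; apply: cvgD; last exact: cvg_cst.
  by apply: cvgM; [exact: cvg_cst|exact: cvg_id].
have fB : mu (f @^-1` B) = 0%E.
  pose k' : {nonneg R} := NngNum (ltW k0).
  pose m := mscale k' (pushforward mu (f : measurableTypeR R -> measurableTypeR R)).
  have mE X : m mf X = (k%:E * mu (f @^-1` X))%E by [].
  have H : mu B = m mf B.
    apply: lebesgue_measure_unique => // _ [[a b] _ <-].
    change (mu `]a, b] = (k%:E * mu (f @^-1` `]a, b]%classic))%E).
    rewrite (_ : _ @^-1` _ = `](a - c) / k, (b - c) / k]%classic); last first.
      apply/seteqP; split => s /=; rewrite !in_itv/= /f.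
        by rewrite ltr_pdivrMr// ler_pdivlMr// (mulrC s); lra.
      by rewrite ltr_pdivrMr// ler_pdivlMr// (mulrC s); lra.
    rewrite !lebesgue_measure_itv/= !lte_fin ltr_pM2r ?invr_gt0// ltrD2r.
    case: ifPn => _; last by rewrite mule0.
    by rewrite -EFinM; congr EFin; field; rewrite gt_eqF.
  move: H; rewrite B0 mE => /esym/eqP.
  by rewrite mule_eq0 eqe gt_eqF//= => /eqP.
exists (f @^-1` B); split => //.
- by rewrite -[X in measurable X]setTI; exact: mf.
- by move=> s /= /AB.
Qed.

(** A countable base of the line, indexed so that it can be enumerated. *)
Definition qitv (q : rat * rat) : set R := [set s | ratr q.1 < s < ratr q.2].

Lemma qitv_ball (s e : R) : 0 < e ->
  exists2 q, qitv q s & forall x, qitv q x -> `|x - s| < e.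
Proof.
move=> e0.
have /rat_in_itvoo[a /[!in_itv]/= ha] : s - e < s by lra.
have /rat_in_itvoo[b /[!in_itv]/= hb] : s < s + e by lra.
by exists (a, b) => [|x]; rewrite /qitv/= ?ltr_distl; lra.
Qed.

Lemma open_qitv (U : set R) s : open U -> U s ->
  exists2 q, qitv q s & qitv q `<=` U.
Proof.
move=> oU Us; have /nbhs_ballP[e /= e0 eU] := open_nbhs_nbhs (conj oU Us).
have [q qs qe] := qitv_ball s e0.
by exists q => // x /qe xe; apply: eU; rewrite /ball/= distrC.
Qed.

(** A Lindelof argument: countably many rational intervals suffice to cover [A]. *)
Lemma negl_locally A :
  (forall s, A s -> exists2 q, qitv q s & negl (A `&` qitv q)) -> negl A.
Proof.
move=> HA.
pose B n : set R := if unpickle n is Some q then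
  [set s | A s /\ qitv q s /\ negl (A `&` qitv q)] else set0.
have : negl (\bigcup_n B n).
  apply: negligible_bigcup => n; rewrite /B.
  case: unpickle => [q|]; last exact: negligible_set0.
  have [nq|nq] := pselect (negl (A `&` qitv q)).
    by apply: negligibleS nq => s [As [qs _]].
  by apply: negligibleS (negligible_set0 _) => s [_ [_ /nq]].
apply: negligibleS => s As; have [q qs nq] := HA s As.
have Bs : B (pickle q) s by rewrite /B pickleK.
exact: (ex_intro2 _ _ (pickle q) I Bs).
Qed.

Lemma posm_point A : ~ negl A ->
  exists2 s, A s & forall e : R, 0 < e -> ~ negl (A `&` [set x | `|x - s| < e]).
Proof.
move=> nA; apply: contrapT => H; apply: nA; apply: negl_locally => s As.
apply: contrapT => H'; apply: H; exists s => // e e0 ne; apply: H'.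
have [q qs qe] := qitv_ball s e0; exists q => //.
by apply: negligibleS ne => x [Ax /qe].
Qed.

Lemma mu_ball_le (c h : R) : 0 <= h ->
  (mu [set s | (`|s - c| < h)%R] <= (h * 2)%:E)%E.
Proof.
move=> h0; rewrite (_ : [set s | _] = ball c h); last first.
  by apply/seteqP; split => s /=; rewrite /ball/= distrC.
by rewrite lebesgue_measure_ball// mulr_natr.
Qed.

(** Subadditivity and the geometric series [sum_j 2 * e / 2^j = 4 * e]; a negative radius gives an
    empty ball. *)
Lemma mu_bigcup_ball (c h : nat -> R) (e : R) : 0 <= e ->
  (forall j, h j <= e * 2^-1 ^+ j) ->
  (mu (\bigcup_j [set s | (`|s - c j| < h j)%R]) <= (4 * e)%:E)%E.
Proof.
move=> e0 he.
apply: le_trans (outer_measure_sigma_subadditive ((@wlength R idfun)^*)%mu _) _.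
apply: (@le_trans _ _ (\sum_(j <oo) ((4 * e) / (2 ^+ (j + 1)))%:E)%E).
  apply: lee_nneseries => [*|j *]; first exact: outer_measure_ge0.
  have [h0|h0] := leP 0 (h j).
    apply: le_trans (mu_ball_le _ h0) _.
    rewrite lee_fin; have := he j; rewrite addn1 exprS exprVn.
    set z := 2 ^+ j; have : 0 < z by rewrite exprn_gt0.
    by move=> z0; rewrite invfM; have := invr_gt0 z; rewrite z0; nra.
  rewrite (_ : [set s | _] = set0) ?outer_measure0 ?lee_fin; last first.
    by apply/seteqP; split => s //=; have := normr_ge0 (s - c j); lra.
  by rewrite divr_ge0// ?mulr_ge0// exprn_ge0.
have := @cvg_geometric_eseries_half R (4 * e) 0.
rewrite expr0 divr1.
rewrite [X in eseries X](_ : _ = (fun k => ((4 * e) / 2 ^+ (k + 1))%:E)).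
  by move/cvg_lim => <-.
by apply/funext => k; rewrite natrX addn1.
Qed.

(** Any [e] with [4 * e < mu A] works: balls of such radii cannot cover [A] up to a null set. *)
Lemma posm_budget A : ~ negl A -> exists2 e : R, 0 < e &
  forall c h : nat -> R, (forall j, h j <= e * 2^-1 ^+ j) ->
    ~ negl (A `\` \bigcup_j [set s | `|s - c j| < h j]).
Proof.
move=> /lebesgue_gt0P A0.
have [e e0 eA] : exists2 e : R, 0 < e & ((4 * e)%:E < mu A)%E.
  case: (mu A) A0 => [r|_|//].
    by rewrite lte_fin => r0; exists (r / 8); rewrite ?lte_fin; lra.
  by exists 1 => //; rewrite ltry.
exists e => // c h he nA.
have : (mu A <= (4 * e)%:E)%E.
  apply: le_trans (mu_bigcup_ball c (ltW e0) he).
  rewrite -[leRHS]add0e; have /negl_lebesgue0 <- := nA.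
  apply: le_trans (lebesgue_setU_le _ _); apply: lebesgue_sub_le => s As.
  have [Bs|Bs] := pselect ((\bigcup_j [set s | `|s - c j| < h j]) s).
    by right.
  by left.
by rewrite leNgt eA.
Qed.

(** Borel-Cantelli: the balls from index [m] on have total measure at most [4 * e / 2^m]. *)
Lemma negl_limsup_ball (c h : nat -> R) (e : R) : 0 <= e ->
  (forall j, h j <= e * 2^-1 ^+ j) ->
  negl [set s | forall m, exists2 j, (m <= j)%N & `|s - c j| < h j].
Proof.
move=> e0 he; apply/negl_lebesgue0.
set N := [set s | _]; apply/eqP; rewrite eq_le.
rewrite (outer_measure_ge0 ((@wlength R idfun)^*)%mu) andbT.
apply/lee_addgt0Pr => x x0; rewrite add0e.
have [m hm] : exists m, 4 * (e * 2^-1 ^+ m) <= x.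
  have : (fun n => 4 * e * 2^-1 ^+ n) @ \oo --> (0 : R).
    rewrite -[X in _ --> X](mulr0 (4 * e)); apply: cvgM; first exact: cvg_cst.
    by apply: cvg_expr; rewrite gtr0_norm ?invr_gt0// invf_lt1// ltr1n.
  move=> /cvgrPdist_lt/(_ x x0)[m _ /(_ m (leqnn _))].
  rewrite sub0r normrN => /ltW H; exists m; rewrite mulrA.
  by apply: le_trans H; exact: ler_norm.
apply: le_trans (le_trans (@mu_bigcup_ball (fun j => c (m + j)%N)
  (fun j => h (m + j)%N) (e * 2^-1 ^+ m) _ _) _).
- apply: lebesgue_sub_le => s /(_ m)[j mj sj].
  by exists (j - m)%N => //=; rewrite subnKC.
- by rewrite mulr_ge0// exprn_ge0.
- by move=> j; rewrite -mulrA -exprD.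
- by rewrite lee_fin.
Qed.

End LebesgueNegligible.

(** * Curves with prescribed slopes *)

Section Slopes.
Context {R : realType} {d : nat}.
Implicit Types (f : R -> 'rV[R]_d) (a b c r s t : R) (v w : 'rV[R]_d).

(** Chords are bounded rather than derivatives, since such bounds pass to limits and to splices.
    With [w = 0] this is a Lipschitz bound; with [r = 0] it says that [f] is affine with slope
    [w]. *)
Definition slopes_in f a b w r := forall s t, a <= s <= b -> a <= t <= b ->
  enorm (f s - f t - (s - t) *: w) <= r * `|s - t|.

Lemma slopes_in_sym f a b w r :
  (forall s t, a <= t -> t <= s -> s <= b ->
     enorm (f s - f t - (s - t) *: w) <= r * (s - t)) ->
  slopes_in f a b w r.
Proof.
move=> H s t /andP[as_ sb] /andP[at_ tb].
have [ts|/ltW st] := leP t s; first by rewrite ger0_norm ?subr_ge0// H.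
rewrite ler0_norm ?subr_le0// opprB -enormN.
rewrite (_ : - _ = f t - f s - (t - s) *: w) ?H//.
by apply/rowP => i; rewrite !mxE; ring.
Qed.

Lemma slopes_in_le f a b w r r' : r <= r' ->
  slopes_in f a b w r -> slopes_in f a b w r'.
Proof.
by move=> rr' H s t sab tab; apply: le_trans (H _ _ sab tab) _; rewrite ler_wpM2r.
Qed.

Lemma slopes_in_eq f g a b w r : (forall s, a <= s <= b -> f s = g s) ->
  slopes_in f a b w r -> slopes_in g a b w r.
Proof. by move=> fg H s t sab tab; rewrite -!fg//; exact: H. Qed.

Lemma chord_triangle f w s c t :
  enorm (f s - f t - (s - t) *: w) <=
  enorm (f s - f c - (s - c) *: w) + enorm (f c - f t - (c - t) *: w).
Proof.
apply: le_trans (enormD _ _); rewrite le_eqVlt; apply/orP; left; apply/eqP.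
congr enorm; apply/rowP => i; rewrite !mxE; ring.
Qed.

Lemma slopes_in_glue f a b c w r :
  slopes_in f a b w r -> slopes_in f b c w r -> slopes_in f a c w r.
Proof.
move=> H1 H2; apply: slopes_in_sym => s t at_ ts sc.
have [sb|/ltW bs] := leP s b.
  by have := H1 s t; rewrite ger0_norm ?subr_ge0//; apply; lra.
have [bt|/ltW tb] := leP b t.
  by have := H2 s t; rewrite ger0_norm ?subr_ge0//; apply; lra.
apply: le_trans (chord_triangle f w s b t) _.
have : enorm (f s - f b - (s - b) *: w) <= r * `|s - b| by apply: H2; lra.
have : enorm (f b - f t - (b - t) *: w) <= r * `|b - t| by apply: H1; lra.
by rewrite !ger0_norm ?subr_ge0//; lra.
Qed.

Lemma slopes_in_ball f a b w w' r r' : enorm (w - w') + r <= r' ->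
  slopes_in f a b w r -> slopes_in f a b w' r'.
Proof.
move=> rr H s t sab tab.
rewrite (_ : _ - _ = (f s - f t - (s - t) *: w) + (s - t) *: (w - w')); last first.
  by apply/rowP => i; rewrite !mxE; ring.
apply: le_trans (enormD _ _) _; rewrite enormZ.
apply: le_trans (ler_wpM2r (normr_ge0 _) rr).
by rewrite mulrDl addrC mulrC lerD2l H.
Qed.

Lemma slopes_in_affine f c rho k x w r : 0 < k -> k * x <= rho ->
  slopes_in f (c - rho) (c + rho) w r ->
  slopes_in (fun s => f (k * s + c)) (- x) x (k *: w) (k * r).
Proof.
move=> k0 kx H s t sx tx.
have := H (k * s + c) (k * t + c).
rewrite (_ : k * s + c - (k * t + c) = k * (s - t)); last by ring.
rewrite scalerA [_ * k]mulrC normrM gtr0_norm// mulrA [r * k]mulrC; apply; nra.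
Qed.

Lemma slopes_in0 f a b r :
  (forall s t, a <= s <= b -> a <= t <= b -> enorm (f s - f t) <= r * `|s - t|) <->
  slopes_in f a b 0 r.
Proof.
by split=> H s t sab tab; have := H s t sab tab; rewrite scaler0 subr0.
Qed.

Lemma slopes_in_lim (F : nat -> R -> 'rV[R]_d) f a b w r (n0 : nat) :
  (forall s (e : R), 0 < e ->
     exists n1, forall n, (n1 <= n)%N -> enorm (F n s - f s) <= e) ->
  (forall n, (n0 <= n)%N -> slopes_in (F n) a b w r) ->
  slopes_in f a b w r.
Proof.
move=> Ff H s t sab tab; apply/ler_addgt0Pr => e e0.
have e2 : 0 < e / 2 by rewrite divr_gt0.
have [n1 h1] := Ff s (e / 2) e2.
have [n2 h2] := Ff t (e / 2) e2.
pose n := maxn n0 (maxn n1 n2).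
have {}h1 : enorm (F n s - f s) <= e / 2 by apply: h1; rewrite /n !leq_max leqnn !orbT.
have {}h2 : enorm (F n t - f t) <= e / 2 by apply: h2; rewrite /n !leq_max leqnn !orbT.
have {}H := H n (leq_maxl _ _) s t sab tab.
rewrite (_ : f s - f t - _ = (F n s - F n t - (s - t) *: w)
  + ((F n t - f t) - (F n s - f s))); last by apply/rowP => i; rewrite !mxE; ring.
apply: le_trans (enormD _ _) _.
by have := enormD (F n t - f t) (- (F n s - f s)); rewrite enormN; lra.
Qed.

Lemma deriv_within_chord A f s v : deriv_within A f s v -> forall e, 0 < e ->
  exists2 del : R, 0 < del & forall x, A x -> `|x - s| < del ->
    enorm (f x - f s - (x - s) *: v) <= e * `|x - s|.
Proof.
move=> [_ H] e e0; have [del del0 Hd] := H e e0; exists del => // x Ax xs.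
have [->|xs0] := eqVneq x s.
  by rewrite !subrr scale0r subr0 enorm0 normr0 mulr0.
have xs1 : 0 < `|x - s| by rewrite normr_gt0 subr_eq0.
have := Hd x Ax; rewrite xs1 => /(_ xs)/ltW H'.
rewrite (_ : _ - _ = (x - s) *: ((x - s)^-1 *: (f x - f s) - v)).
  by rewrite enormZ mulrC ler_wpM2r.
by rewrite scalerBr scalerA divff ?scale1r// subr_eq0.
Qed.

Lemma chord_deriv_within A f s v : A s ->
  (forall e, 0 < e -> exists2 del : R, 0 < del & forall x, A x -> `|x - s| < del ->
    enorm (f x - f s - (x - s) *: v) <= e * `|x - s|) -> deriv_within A f s v.
Proof.
move=> As H; split=> // e e0; have [del del0 Hd] := H (e / 2) ltac:(lra).
exists del => // x Ax /andP[xs0 xs]; have := Hd x Ax xs.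
rewrite (_ : _ - _ = (x - s) *: ((x - s)^-1 *: (f x - f s) - v)).
  rewrite enormZ mulrC ler_pM2r//; lra.
by rewrite scalerBr scalerA divff ?scale1r// -normr_gt0.
Qed.

(** The local condition carries [P] to the supremum of the points where it holds, and then beyond it
    unless that supremum is [s]. *)
Lemma real_induction (P : R -> Prop) t s : t <= s -> P t ->
  (forall x, t <= x <= s -> exists2 del : R, 0 < del &
     forall y, t <= y <= s -> `|y - x| < del ->
       (y <= x -> P y -> P x) /\ (x <= y -> P x -> P y)) ->
  P s.
Proof.
move=> ts Pt H; pose X := [set x | t <= x <= s /\ P x].
have Xt : X t by split=> //; rewrite lexx ts.
have hX : has_sup X.
  by split; [exists t|exists s => x [/andP[]]].
have tc : t <= sup X by apply: ub_le_sup => //; case: hX.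
have cs : sup X <= s by apply: ge_sup; [exists t|move=> x [/andP[]]].
have [del del0 Hd] := H (sup X) ltac:(lra).
have [x [xts Px] xd] := sup_adherent del0 hX.
have xc : x <= sup X by apply: ub_le_sup => //; case: hX.
have Pc : P (sup X) by have [|/(_ xc Px)] := Hd x xts; rewrite // ltr_distl; lra.
have [<-//|cs'] := eqVneq (sup X) s.
have {cs'}cs : sup X < s by rewrite lt_neqAle cs'.
pose y := Num.min s (sup X + del / 2).
have cy : sup X < y by rewrite /y lt_min cs; lra.
have ys : y <= s by rewrite /y ge_min lexx.
have yd : y <= sup X + del / 2 by rewrite /y ge_min lexx orbT.
have Py : P y.
  by have [||_ /(_ (ltW cy) Pc)] := Hd y; rewrite ?ltr_distl//; lra.
have : y <= sup X by apply: ub_le_sup; [case: hX|split=> //; lra].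
lra.
Qed.

(** The mean value inequality for vector-valued maps, by real induction along [[t, s]] on a bound
    with a slightly larger radius. *)
Lemma mean_value A f f' a b w r :
  (forall s, a <= s <= b -> A s /\ deriv_within A f s (f' s)) ->
  (forall s, a <= s <= b -> enorm (f' s - w) <= r) ->
  slopes_in f a b w r.
Proof.
move=> df fw; apply: slopes_in_sym => s t at_ ts sb.
have key e x : 0 < e -> t <= x <= s -> exists2 del : R, 0 < del &
    forall y, t <= y <= s -> `|y - x| < del ->
      enorm (f y - f x - (y - x) *: w) <= (r + e) * `|y - x|.
  move=> e0 xts; have [_ dx] := df x ltac:(lra).
  have [del del0 Hd] := deriv_within_chord dx e0.
  exists del => // y yts yx.
  have {Hd}Hd := Hd y (df y ltac:(lra)).1 yx.
  rewrite (_ : _ - _ = (f y - f x - (y - x) *: f' x) + (y - x) *: (f' x - w)).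
    apply: le_trans (enormD _ _) _; rewrite enormZ addrC mulrDl lerD// mulrC.
    by rewrite ler_wpM2r// fw//; lra.
  by apply/rowP => i; rewrite !mxE; ring.
apply/ler_addgt0Pr => e e0.
have [ts'|ts'] := eqVneq t s.
  by rewrite ts' !subrr scale0r subrr enorm0; lra.
have ts0 : 0 < s - t by rewrite subr_gt0 lt_neqAle ts'.
(* Local errors at rate [e1] accumulate to [e] over the whole of [[t, s]]. *)
pose e1 := e / (s - t).
have e10 : 0 < e1 by rewrite divr_gt0.
pose P x := enorm (f x - f t - (x - t) *: w) <= (r + e1) * (x - t).
suff : P s by rewrite /P mulrDl /e1 mulfVK// gt_eqF.
apply: (@real_induction P t s) => //.
  by rewrite /P !subrr scale0r subrr enorm0 mulr0.
move=> x xts; have [del del0 Hd] := key e1 x e10 xts.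
exists del => // y yts yx; have {Hd}Hd := Hd y yts yx.
split=> xy; rewrite /P => Py.
  have := chord_triangle f w x y t.
  have : enorm (f x - f y - (x - y) *: w) = enorm (f y - f x - (y - x) *: w).
    by rewrite -enormN; congr enorm; apply/rowP => i; rewrite !mxE; ring.
  by move: Hd; rewrite ler0_norm ?subr_le0//; nra.
have := chord_triangle f w y x t.
by move: Hd; rewrite ger0_norm ?subr_ge0//; nra.
Qed.

(** Compare the derivative with a short chord from [s] to a point on its right. *)
Lemma deriv_within_slope A f a b w r s v : a < s < b ->
  (forall x, a <= x <= b -> A x) ->
  slopes_in f a b w r -> deriv_within A f s v -> enorm (v - w) <= r.
Proof.
move=> sab Aab H ds; apply/ler_addgt0Pr => e e0.
have [del del0 Hd] := deriv_within_chord ds e0.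
pose x := s + Num.min (del / 2) (b - s).
have x0 : 0 < Num.min (del / 2) (b - s) by rewrite lt_min; lra.
have x1 : Num.min (del / 2) (b - s) <= del / 2 by rewrite ge_min lexx.
have x2 : Num.min (del / 2) (b - s) <= b - s by rewrite ge_min lexx orbT.
have xs : x - s = Num.min (del / 2) (b - s) by rewrite /x addrC addKr.
have {}Hd : enorm (f x - f s - (x - s) *: v) <= e * `|x - s|.
  by apply: Hd; [apply: Aab; lra|rewrite gtr0_norm; lra].
have {}H : enorm (f x - f s - (x - s) *: w) <= r * `|x - s| by apply: H; lra.
rewrite -(@ler_pM2l _ `|x - s|) ?xs ?normr_gt0 ?gt_eqF// -xs -enormZ.
rewrite (_ : _ *: _ = (f x - f s - (x - s) *: w) - (f x - f s - (x - s) *: v)).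
  by apply: le_trans (enormD _ _) _; rewrite enormN; lra.
by apply/rowP => i; rewrite !mxE; ring.
Qed.

Lemma deriv_within_affine A f k c s v : 0 < k ->
  (exists2 rho : R, 0 < rho & forall y, `|y - s| < rho -> A (k * y + c)) ->
  deriv_within A f (k * s + c) v ->
  deriv_within [set: R] (fun y => f (k * y + c)) s (k *: v).
Proof.
move=> k0 [rho rho0 Arho] dv; apply: chord_deriv_within => // e e0.
have [del del0 Hd] := deriv_within_chord dv (divr_gt0 e0 k0).
exists (Num.min rho (del / k)); first by rewrite lt_min rho0 divr_gt0.
move=> x _; rewrite lt_min => /andP[xr xd].
have := Hd (k * x + c) (Arho x xr).
rewrite (_ : k * x + c - (k * s + c) = k * (x - s)); last by ring.
rewrite normrM gtr0_norm// mulrA mulfVK ?gt_eqF// scalerA [_ * k]mulrC; apply.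
by rewrite mulrC -ltr_pdivlMr.
Qed.

Lemma deriv_within_near A B f g s v rho : 0 < rho -> A s ->
  (forall x, A x -> `|x - s| < rho -> B x /\ g x = f x) ->
  deriv_within B f s v -> deriv_within A g s v.
Proof.
move=> rho0 As H dv; apply: chord_deriv_within => // e e0.
have [del del0 Hd] := deriv_within_chord dv e0.
exists (Num.min rho del); first by rewrite lt_min rho0.
move=> x Ax; rewrite lt_min => /andP[xr xd].
have [Bx ->] := H x Ax xr.
have [_ ->] := H s As ltac:(by rewrite subrr normr0).
exact: Hd.
Qed.

Lemma deriv_within_addZ A f al be s v w : deriv_within A f s v ->
  deriv_within A (fun x => f x + (al * x + be) *: w) s (v + al *: w).
Proof.
move=> dv; apply: chord_deriv_within; first by case: dv.
move=> e e0; have [del del0 Hd] := deriv_within_chord dv e0.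
exists del => // x Ax xs; rewrite (_ : _ - _ = f x - f s - (x - s) *: v) ?Hd//.
by apply/rowP => i; rewrite !mxE; ring.
Qed.

End Slopes.

(** * Hereditary directions *)

Section Directions.
Context {R : realType} {d : nat}.
Implicit Types (u v w : 'rV[R]_d) (U V FF : set 'rV[R]_d) (e : R).
Local Notation mu := (@lebesgue_measure R).
Local Notation negl := (mu.-negligible).

Definition dirv w : 'rV[R]_d := (enorm w)^-1 *: w.

Lemma enorm_gt0 w : w != 0 -> 0 < enorm w.
Proof.
move=> w0; rewrite lt_def enorm_ge0 andbT.
by apply: contra w0 => /eqP/enorm_eq0 ->.
Qed.

Lemma enorm_dirv w : w != 0 -> enorm (dirv w) = 1.
Proof.
move=> /enorm_gt0 w0.
by rewrite /dirv enormZ gtr0_norm ?invr_gt0// mulVf// gt_eqF.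
Qed.

Lemma unit_net e : 0 < e -> exists l : seq 'rV[R]_d,
  (forall u, u \in l -> enorm u = 1) /\
  (forall w, enorm w = 1 -> exists2 u, u \in l & enorm (w - u) < e).
Proof.
move=> e0; pose S := [set w : 'rV[R]_d | enorm w = 1].
have cS : compact S.
  apply: bounded_closed_compact.
    exists 1; split; first exact: num_real.
    move=> M M1 w /= w1; change (mx_norm w <= M); rewrite mx_normrE.
    apply: bigmax_le => [|[i j] _] /=; first by lra.
    by rewrite (ord1 i) (le_trans (enorm_coord w j))// w1 ltW.
  rewrite -[S]setCK; apply: open_closedC; apply: enorm_open => x /= x1.
  exists (`|enorm x - 1|); first by rewrite normr_gt0 subr_eq0; apply/eqP.
  move=> y yx y1; have := enorm_dist y x; rewrite y1 distrC; lra.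
move: cS; rewrite compact_cover => cS.
have [u _|w wS|D DS SD] := cS _ S (fun u => [set y | enorm (y - u) < e]).
- exact: open_eball.
- by exists w => //=; rewrite subrr enorm0.
exists (finmap.enum_fset D); split=> [u uD|w wS]; first by have := DS u uD; rewrite inE.
by have [u uD /= wu] := SD w wS; exists u.
Qed.

Definition portion FF U := open U /\ U `&` FF !=set0.

Definition hits_along FF V u e := exists nu nu' : R -> 'rV[R]_d,
  [/\ forall s, unit_interval s -> deriv_within (@unit_interval R) nu s (nu' s),
      forall s, unit_interval s -> cont_within (@unit_interval R) nu' s,
      forall s, unit_interval s -> nu' s != 0 &
      ~ negl [set s | unit_interval s /\ (V `&` FF) (nu s) /\
                      enorm (dirv (nu' s) - u) < e]].

Definition hereditary FF U u e := forall V, portion FF V -> V `<=` U ->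
  hits_along FF V u e.

Lemma hits_alongS FF V V' u e : V `<=` V' -> hits_along FF V u e ->
  hits_along FF V' u e.
Proof.
move=> VV' [nu [nu' [h1 h2 h3 h4]]]; exists nu, nu'; split=> // n; apply: h4.
by apply: negligibleS n => s [? [[/VV' ? ?] ?]].
Qed.

Lemma hereditaryS FF U U' u e : U' `<=` U -> hereditary FF U u e ->
  hereditary FF U' u e.
Proof. by move=> UU' H V pV VU'; apply: H => //; exact: subset_trans UU'. Qed.

Lemma negl_seq_cover (l : seq 'rV[R]_d) (B : 'rV[R]_d -> set R) :
  (forall u, u \in l -> negl (B u)) -> negl [set s | exists2 u, u \in l & B u s].
Proof.
elim: l => [_|u l IH H].
  by apply: negligibleS (negligible_set0 _) => s [].
have nl := IH (fun v vl => H v ltac:(by rewrite inE vl orbT)).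
have nu := H u ltac:(by rewrite inE eqxx).
apply: negligibleS (negligibleU nu nl) => s [v].
by rewrite inE => /orP[/eqP ->|vl] Bv; [left|right; exists v].
Qed.

(** Directions are discarded one by one: if [u] is not hereditary, some smaller portion is not hit
    along [u], and neither is any portion inside it. *)
Lemma hereditary_dichotomy FF e (l : seq 'rV[R]_d) U : portion FF U ->
  (exists U' u, [/\ portion FF U', U' `<=` U, u \in l & hereditary FF U' u e]) \/
  (exists V, [/\ portion FF V, V `<=` U & forall u, u \in l -> ~ hits_along FF V u e]).
Proof.
elim: l U => [U pU|u l IH U pU]; first by right; exists U; split.
have [hU|nhU] := pselect (hereditary FF U u e).
  by left; exists U, u; split=> //; rewrite inE eqxx.
have [V [pV VU nV]] : exists V, [/\ portion FF V, V `<=` U & ~ hits_along FF V u e].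
  apply: contrapT => H; apply: nhU => V pV VU; apply: contrapT => nV.
  by apply: H; exists V.
have [[U' [u' [pU' U'V u'l hU']]]|[V' [pV' V'V nV']]] := IH V pV.
  left; exists U', u'; split=> //; first exact: subset_trans VU.
  by rewrite inE u'l orbT.
right; exists V'; split=> //; first exact: subset_trans VU.
move=> v; rewrite inE => /orP[/eqP ->|/nV'//].
by move=> h; apply: nV; exact: hits_alongS h.
Qed.

(* A portion on which no direction of a finite net is hereditary would contain
   a portion missed by all directions of the net. *)
Lemma hereditary_refine FF U u0 e0 e : portion FF U -> hereditary FF U u0 e0 ->
  0 < e -> exists U' u, [/\ portion FF U', U' `<=` U, enorm u = 1,
    enorm (u - u0) < e0 + e & hereditary FF U' u e].
Proof.
move=> pU hU ep; have [l [l1 lnet]] := unit_net ep.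
(* A tangent within [e0] of [u0] and within [e] of [u] puts [u] within [e0 + e] of [u0], so only
   these net points matter. *)
pose l' := [seq u <- l | enorm (u - u0) < e0 + e].
have [[U' [u [pU' U'U]]]|[V [pV VU nV]]] := hereditary_dichotomy e l' pU.
  by rewrite mem_filter => /andP[uu0 /l1 u1] hU'; exists U', u.
have [nu [nu' [h1 h2 h3 h4]]] := hU V pV VU.
exfalso; apply: h4.
(* The hits along [u0] are covered by the finitely many [B u]; each is empty or negligible, because
   [V] is hit along no direction of [l']. *)
pose B u := [set s | [/\ unit_interval s, (V `&` FF) (nu s),
  enorm (dirv (nu' s) - u0) < e0 & enorm (dirv (nu' s) - u) < e]].
have nB : negl [set s | exists2 u, u \in l & B u s].
  apply: negl_seq_cover => u ul; apply: contrapT => nBu.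
  have [s [us _ su0 su]] := posm_nonempty nBu.
  have ul' : u \in l'.
    rewrite mem_filter ul andbT.
    have := enorm_trans (dirv (nu' s)) u u0; rewrite (enormB u (dirv _)); lra.
  apply: (nV u ul'); exists nu, nu'; split=> // nS; apply: nBu.
  by apply: negligibleS nS => x [].
apply: negligibleS nB => s [us [VFs su0]].
have [u ul su] := lnet _ (enorm_dirv (h3 s us)).
by exists u.
Qed.

(** Near a parameter at which the hits have positive measure at every scale, the curve is almost
    affine with velocity a positive multiple of [u]. An affine change of parameter brings its speed
    just below one; the slack [sg] leaves room for later splices. *)
Lemma hits_piece FF V u e (tau0 : R) : 0 < e -> 0 < tau0 -> enorm u = 1 ->
  hits_along FF V u e ->
  exists (tau : R) (nu : R -> 'rV[R]_d) (sg : R),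
  [/\ 0 < tau <= tau0, 0 < sg, slopes_in nu (- tau) tau u (8 * e - sg),
      slopes_in nu (- tau) tau 0 (1 - sg) &
      ~ negl [set s | `|s| < tau /\ (V `&` FF) (nu s)] /\
      forall s, `|s| < tau -> exists v, deriv_within [set: R] nu s v].
Proof.
move=> e0 tau00 u1 [nu [nu' [h1 h2 h3 h4]]].
(* Dropping both endpoints makes [s0] interior to the unit interval. *)
have := posm_setD (posm_setD h4 (negl_point 0)) (negl_point 1).
set A := _ `\` _ => nA.
have [s0 [[[/andP[s00 s01] [_ s0u]] s0n0] s0n1] s0P] := posm_point nA.
have {}s00 : 0 < s0 by rewrite lt_neqAle s00 andbT eq_sym; apply/eqP.
have {}s01 : s0 < 1 by rewrite lt_neqAle s01 andbT; apply/eqP.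
have us0 : unit_interval s0 by rewrite /unit_interval/=; lra.
have n0 := enorm_gt0 (h3 s0 us0); set n := enorm (nu' s0) in n0.
have [del del0 Hd] := h2 s0 us0 _ (mulr_gt0 n0 e0).
pose rho := Num.min (del / 2) (Num.min (s0 / 2) ((1 - s0) / 2)).
have rho0 : 0 < rho by rewrite !lt_min; lra.
have rho1 : rho <= del / 2 by rewrite ge_min lexx.
have rho2 : rho <= s0 / 2 by rewrite !ge_min lexx orbT.
have rho3 : rho <= (1 - s0) / 2 by rewrite !ge_min lexx !orbT.
have inU s : s0 - rho <= s <= s0 + rho -> unit_interval s.
  by rewrite /unit_interval/=; lra.
have sl : slopes_in nu (s0 - rho) (s0 + rho) (n *: u) (2 * (n * e)).
  have : slopes_in nu (s0 - rho) (s0 + rho) (nu' s0) (n * e).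
    apply: (@mean_value _ _ (@unit_interval R) nu nu') => s sr.
      by split; [exact: inU|apply: h1; exact: inU].
    by apply/ltW/Hd; [exact: inU|rewrite ltr_distl; lra].
  apply: slopes_in_ball.
  rewrite (_ : nu' s0 - n *: u = n *: (dirv (nu' s0) - u)); last first.
    by rewrite scalerBr /dirv scalerA divff ?scale1r// gt_eqF.
  rewrite enormZ gtr0_norm//; have := ler_wpM2l (ltW n0) (ltW s0u); lra.
(* After rescaling, chord slopes lie within [2 * ka * e] of [ka *: u]. This [ka] solves
   [ka + 2 * ka * e = 1 - ka * e], which is the Lipschitz bound with slack [ka * e]. *)
pose ka : R := (1 + 3 * e)^-1.
have kae : ka * (1 + 3 * e) = 1 by rewrite mulVf// gt_eqF//; lra.
have ka0 : 0 < ka by rewrite invr_gt0; lra.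
pose k := ka / n.
have k0 : 0 < k by rewrite divr_gt0.
have kn : k * n = ka by rewrite /k mulfVK// gt_eqF.
pose tau := Num.min tau0 (rho / k).
have tau1 : tau <= tau0 by rewrite ge_min lexx.
have tau2 : k * tau <= rho by rewrite mulrC -ler_pdivlMr// ge_min lexx orbT.
have tauP : 0 < tau by rewrite lt_min tau00 divr_gt0.
have slk := slopes_in_affine k0 tau2 sl.
rewrite scalerA kn (_ : k * (2 * (n * e)) = 2 * (ka * e)) in slk; last first.
  by rewrite -kn; ring.
exists tau, (fun s => nu (k * s + s0)), (ka * e); split.
- by rewrite tauP tau1.
- by rewrite mulr_gt0.
- apply: slopes_in_ball slk.
  rewrite (_ : ka *: u - u = (ka - 1) *: u); last by rewrite scalerBl scale1r.
  rewrite enormZ u1 mulr1 ler0_norm; nra.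
- apply: slopes_in_ball slk.
  rewrite subr0 enormZ u1 mulr1 gtr0_norm//; nra.
split=> [nN|s stau].
  apply: (s0P (k * tau)); first exact: mulr_gt0.
  have ki0 : 0 < k^-1 by rewrite invr_gt0.
  apply: negligibleS (negl_affine (- (s0 / k)) ki0 nN) => s [[[[_ [VFs _]] _] _] /= ss].
  have E : k^-1 * s - s0 / k = (s - s0) / k by ring.
  have E2 : k * (k^-1 * s - s0 / k) + s0 = s by field; rewrite gt_eqF.
  rewrite /= E2 E; split=> //.
  by rewrite normrM (gtr0_norm ki0) ltr_pdivrMr// mulrC.
have inS x : `|x| < tau -> unit_interval (k * x + s0).
  by move=> xt; apply: inU; move: xt; rewrite ltr_norml => /andP[? ?]; nra.
exists (k *: nu' (k * s + s0)).
apply: (@deriv_within_affine _ _ (@unit_interval R)) => //.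
  exists (tau - `|s|); first lra.
  move=> y ys; apply: inS; have := ler_normD (y - s) s; rewrite subrK; lra.
exact/h1/inS.
Qed.

End Directions.

(** * Splicing a piece into a curve *)

Section Splice.
Context {R : realType} {d : nat}.
Implicit Types (g nu : R -> 'rV[R]_d) (w : 'rV[R]_d).
Local Notation mu := (@lebesgue_measure R).
Local Notation negl := (mu.-negligible).

Definition clamp (t tau s : R) : R := Num.max (t - tau) (Num.min (t + tau) s).

Definition ramp (t tau h s : R) : R :=
  Num.min 1 (Num.max 0 ((h - `|s - t|) / (h - tau))).

(* On [|s - t| <= tau] this is [nu (s - t)], for [|s - t| >= h] it is [g s]; in
   between a constant displacement is faded out linearly. *)
Definition splice g nu t tau h s : 'rV[R]_d :=
  g s + ramp t tau h s *: (nu (clamp t tau s - t) - g (clamp t tau s)).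

Lemma clamp_id t tau s : `|s - t| <= tau -> clamp t tau s = s.
Proof.
rewrite ler_distl => /andP[h1 h2]; rewrite /clamp (min_idPr _) ?(max_idPr _)//.
Qed.

Lemma clamp_right t tau s : 0 <= tau -> t + tau <= s -> clamp t tau s = t + tau.
Proof. by move=> t0 ts; rewrite /clamp (min_idPl _)// (max_idPr _)//; lra. Qed.

Lemma clamp_left t tau s : 0 <= tau -> s <= t - tau -> clamp t tau s = t - tau.
Proof.
by move=> t0 ts; rewrite /clamp (min_idPr _) ?(max_idPl _)//; lra.
Qed.

Lemma clamp_dist t tau s : 0 <= tau -> `|clamp t tau s - t| <= tau.
Proof.
move=> t0; rewrite ler_distl /clamp le_max lexx/= ge_max ge_min lexx/= andbT.
by rewrite lerD2l; lra.
Qed.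

Section Params.
Variables (t tau h : R).
Hypothesis tauh : 0 < tau < h.

Let hp : 0 < h - tau.
Proof. by move: tauh; rewrite subr_gt0 => /andP[]. Qed.

Lemma ramp1 s : `|s - t| <= tau -> ramp t tau h s = 1.
Proof.
move=> st; rewrite /ramp; apply/min_idPl; rewrite le_max; apply/orP; right.
by rewrite ler_pdivlMr// mul1r; lra.
Qed.

Lemma ramp0 s : h <= `|s - t| -> ramp t tau h s = 0.
Proof.
move=> st; rewrite /ramp (max_idPl _) ?(min_idPr _)//.
by rewrite pmulr_lle0 ?invr_gt0//; lra.
Qed.

Lemma ramp_mid s : tau <= `|s - t| <= h ->
  ramp t tau h s = (h - `|s - t|) / (h - tau).
Proof.
move=> st; rewrite /ramp (max_idPr _) ?(min_idPr _)//.
  by rewrite ler_pdivrMr// mul1r; lra.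
by rewrite divr_ge0//; lra.
Qed.

Lemma ramp_itv s : 0 <= ramp t tau h s <= 1.
Proof. by rewrite /ramp le_min ge_min lexx ler01 le_max lexx. Qed.

Lemma ramp_lipschitz s s' :
  `|ramp t tau h s - ramp t tau h s'| <= `|s - s'| / (h - tau).
Proof.
have L (a b c e : R) : `|a - b| <= e ->
    `|Num.min c a - Num.min c b| <= e.
  move=> ab; apply: le_trans ab.
  case: (leP c a) => ca; case: (leP c b) => cb; rewrite ?subrr ?normr0//.
    by rewrite !ger0_norm; lra.
  by rewrite !ler0_norm; lra.
have L' (a b c e : R) : `|a - b| <= e ->
    `|Num.max c a - Num.max c b| <= e.
  move=> ab; apply: le_trans ab.
  case: (leP c a) => ca; case: (leP c b) => cb; rewrite ?subrr ?normr0//.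
    by rewrite !ger0_norm; lra.
  by rewrite !ler0_norm; lra.
apply/L/L'; rewrite -mulrBl normrM (gtr0_norm (_ : 0 < (h - tau)^-1)) ?invr_gt0//.
apply: ler_wpM2r; first by rewrite invr_ge0 ltW.
rewrite (_ : _ - _ = `|s' - t| - `|s - t|); last by ring.
by apply: le_trans (ler_dist_dist _ _) _; rewrite distrC; rewrite opprB addrA subrK.
Qed.

Lemma splice_out g nu s : h <= `|s - t| -> splice g nu t tau h s = g s.
Proof. by move=> st; rewrite /splice ramp0// scale0r addr0. Qed.

Lemma splice_in g nu s : `|s - t| <= tau -> splice g nu t tau h s = nu (s - t).
Proof. by move=> st; rewrite /splice ramp1// clamp_id// scale1r addrC subrK. Qed.

Lemma splice_dist g nu eta s :
  (forall x, `|x| <= tau -> enorm (nu x - g (t + x)) <= eta) ->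
  enorm (splice g nu t tau h s - g s) <= eta.
Proof.
move=> H; rewrite /splice addrC addKr enormZ.
have /andP[tau_gt0 tau_lt] := tauh.
have t0 : 0 <= tau by exact: ltW.
have := H _ (clamp_dist t s t0); rewrite [t + _]addrC subrK => H'.
have /andP[r0 r1] := ramp_itv s.
rewrite ger0_norm//; have := enorm_ge0 (nu (clamp t tau s - t) - g (clamp t tau s)).
nra.
Qed.

(** On each side of the inner interval the clamp is constant, so the splice adds to [g] a fixed
    vector of norm at most [eta] times a ramp of Lipschitz constant [1 / (h - tau)]. Inside, the
    slopes are those of [nu]. The three ranges are glued. *)
Lemma splice_slopes g nu eta (a b : R) w r r' :
  (forall x, `|x| <= tau -> enorm (nu x - g (t + x)) <= eta) ->
  a <= t - tau -> t + tau <= b ->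
  slopes_in g a b w r -> slopes_in nu (- tau) tau w r' ->
  r + eta / (h - tau) <= r' ->
  slopes_in (splice g nu t tau h) a b w r'.
Proof.
move=> H at_ tb sg sn rr'.
have /andP[tau_gt0 tau_lt] := tauh.
have t0 : 0 <= tau by exact: ltW.
have eta0 : 0 <= eta by apply: le_trans (enorm_ge0 _) (H 0 _); rewrite normr0.
have out a' b' z : a <= a' -> b' <= b -> `|z| <= tau ->
    (forall s, a' <= s <= b' -> clamp t tau s = t + z) ->
    slopes_in (splice g nu t tau h) a' b' w r'.
  move=> aa bb zt cl; apply: (slopes_in_le rr') => s s' sab s'ab.
  rewrite /splice !cl// [t + z - t]addrC addKr.
  set D := nu z - _.
  rewrite (_ : _ - _ = (g s - g s' - (s - s') *: w)
    + (ramp t tau h s - ramp t tau h s') *: D); last first.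
    by apply/rowP => i; rewrite !mxE; ring.
  apply: le_trans (enormD _ _) _; rewrite mulrDl lerD//; first by apply: sg; lra.
  rewrite enormZ mulrAC -mulrA mulrC.
  by apply: ler_pM; rewrite ?enorm_ge0 ?ramp_lipschitz ?H.
apply: (@slopes_in_glue _ _ _ _ (t - tau)).
  apply: (out _ _ (- tau)) => //; first lra.
    by rewrite normrN ger0_norm.
  by move=> s sat; rewrite clamp_left//; lra.
apply: (@slopes_in_glue _ _ _ _ (t + tau)); last first.
  apply: (out _ _ tau) => //; first lra.
    by rewrite ger0_norm.
  by move=> s sat; rewrite clamp_right//; lra.
move=> s s' st s't; rewrite !splice_in ?ler_distl//; try lra.
have := sn (s - t) (s' - t).
rewrite (_ : s - t - (s' - t) = s - s'); last by ring.
by apply; lra.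
Qed.

(** Away from the four break points the splice is locally a translate of [nu], or [g], or [g] plus
    an affine map. *)
Lemma splice_deriv A g nu s : A s ->
  (forall x, `|x| < tau -> exists v, deriv_within [set: R] nu x v) ->
  (exists v, deriv_within A g s v) ->
  s != t - h -> s != t - tau -> s != t + tau -> s != t + h ->
  exists v, deriv_within A (splice g nu t tau h) s v.
Proof.
move=> As dn [v dg] n1 n2 n3 n4.
have /andP[tau_gt0 tau_lt] := tauh.
have t0 : 0 <= tau by exact: ltW.
have [st|st] := ltP `|s - t| tau.
  have [v' dv'] := dn _ st.
  exists (1 *: v'); apply: (@deriv_within_near _ _ A [set: R]
     (fun y => nu (1 * y - t)) _ s _ (tau - `|s - t|)) => //.
  - by lra.
  - move=> x Ax xs; split=> //; rewrite mul1r splice_in//.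
    have := ler_normD (x - s) (s - t); rewrite addrA subrK; lra.
  - apply: (@deriv_within_affine _ _ [set: R]) => //; first by exists 1.
    by rewrite mul1r.
have [st'|st'] := ltP h `|s - t|.
  exists v; apply: (deriv_within_near (rho := `|s - t| - h) _ As _ dg).
    by lra.
  move=> x Ax xs; split=> //; rewrite splice_out//.
  have := ler_normD (s - x) (x - t); rewrite addrA subrK (distrC s x); lra.
have [sp|sn] := leP t s.
  have s1 : t + tau < s.
    by move: st; rewrite ger0_norm ?subr_ge0// lt_neqAle eq_sym n3/=; lra.
  have s2 : s < t + h.
    by move: st'; rewrite ger0_norm ?subr_ge0// lt_neqAle n4/=; lra.
  exists (v + (- (h - tau)^-1) *: (nu tau - g (t + tau))).
  apply: (@deriv_within_near _ _ A A _ _ s _ (Num.min (s - (t + tau)) (t + h - s)))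
    (deriv_within_addZ _ ((h + t) / (h - tau)) _ dg) => //.
    by rewrite lt_min; lra.
  move=> x Ax; rewrite lt_min !ltr_distl => /andP[x1 x2]; split=> //.
  rewrite /splice clamp_right//; last lra.
  rewrite ramp_mid; last by rewrite ger0_norm; lra.
  rewrite [t + tau - t]addrC addKr ger0_norm; last lra.
  by congr (_ + _ *: _); field; rewrite gt_eqF.
have sn' : s - t <= 0 by lra.
have s1 : s < t - tau.
  by move: st; rewrite (ler0_norm sn') lt_neqAle n2/=; lra.
have s2 : t - h < s.
  by move: st'; rewrite (ler0_norm sn') lt_neqAle eq_sym n1/=; lra.
exists (v + (h - tau)^-1 *: (nu (- tau) - g (t - tau))).
apply: (@deriv_within_near _ _ A A _ _ s _ (Num.min (t - tau - s) (s - (t - h))))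
  (deriv_within_addZ _ ((h - t) / (h - tau)) _ dg) => //.
  by rewrite lt_min; lra.
move=> x Ax; rewrite lt_min !ltr_distl => /andP[x1 x2]; split=> //.
rewrite /splice clamp_left//; last lra.
rewrite ramp_mid; last by rewrite ler0_norm; lra.
rewrite [t - tau - t]addrC addKr ler0_norm; last lra.
by congr (_ + _ *: _); field; rewrite gt_eqF.
Qed.

End Params.
End Splice.

(** * Stages of the construction *)

(** Indices outside [P] receive radius zero, hence an empty ball, so the radii need a bound only on
    [P]. *)
Lemma posm_avoid {R : realType} (A : set R) (e : R) :
  (forall c h : nat -> R, (forall j, h j <= e * 2^-1 ^+ j) ->
    ~ (@lebesgue_measure R).-negligible
        (A `\` \bigcup_j [set s | `|s - c j| < h j])) ->
  0 < e ->
  forall (P : nat -> Prop) (c h : nat -> R),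
    (forall j, P j -> h j <= e * 2^-1 ^+ j) ->
  ~ (@lebesgue_measure R).-negligible
      [set s | A s /\ forall j, P j -> h j <= `|s - c j|].
Proof.
move=> H e0 P c h hP; pose h' j := if `[< P j >] then h j else 0.
have h'e j : h' j <= e * 2^-1 ^+ j.
  by rewrite /h'; case: asboolP => [/hP//|_]; rewrite mulr_ge0 ?exprn_ge0// ltW.
apply: contra_not (H c h' h'e); apply: negligibleS => s [As sN]; split=> // j Pj.
rewrite leNgt; apply/negP => sj; apply: sN; exists j => //=.
by rewrite /h' asboolT.
Qed.

Lemma finite_min {R : realType} (n : nat) (P : nat -> R -> Prop) :
  (forall k, (k <= n)%N -> exists2 e : R, 0 < e & forall e', 0 < e' <= e -> P k e') ->
  exists2 e : R, 0 < e & forall k, (k <= n)%N -> forall e', 0 < e' <= e -> P k e'.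
Proof.
elim: n => [|n IH] H.
  have [e e0 He] := H 0%N (leqnn _); exists e => // k.
  by rewrite leqn0 => /eqP ->.
have [k kn|e e0 He] := IH; first exact/H/leqW.
have [e1 e10 He1] := H n.+1 (leqnn _).
exists (Num.min e e1); first by rewrite lt_min e0.
move=> k; rewrite leq_eqVlt ltnS => /orP[/eqP ->|kn] e' e'P.
  by apply: He1; have : Num.min e e1 <= e1 by [rewrite ge_min lexx orbT]; lra.
by apply: He => //; have : Num.min e e1 <= e by [rewrite ge_min lexx]; lra.
Qed.

(** Dependent choice for an invariant of the whole past. The step quantifies over all [f'] that
    agree with [f] up to [n], so that [P n] may be transferred between sequences with the same past.
    [G n] is a past that is final up to [n], and the answer is the diagonal. *)
Lemma history_choice (X : Type) (P Q : nat -> (nat -> X) -> Prop) :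
  (exists x, forall f, f 0%N = x -> P 0%N f) ->
  (forall n f, P n f -> exists x, forall f' : nat -> X,
     (forall k, (k <= n)%N -> f' k = f k) -> f' n.+1 = x -> P n.+1 f' /\ Q n f') ->
  exists f : nat -> X, forall n, P n f /\ Q n f.
Proof.
move=> [x0 Hx0] step.
have /choice[nxt Hnxt] : forall nf : nat * (nat -> X), exists x, P nf.1 nf.2 ->
    forall f' : nat -> X, (forall k, (k <= nf.1)%N -> f' k = nf.2 k) ->
      f' nf.1.+1 = x -> P nf.1.+1 f' /\ Q nf.1 f'.
  move=> [n f] /=.
  have [Pf|nPf] := pselect (P n f); last by exists x0.
  by have [x Hx] := step n f Pf; exists x.
pose G := fix G n : nat -> X := if n is m.+1 then
  (fun k => if k == m.+1 then nxt (m, G m) else G m k) else fun=> x0.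
have GE n k : (k <= n)%N -> G n k = G k k.
  elim: n => [|n IH]; first by rewrite leqn0 => /eqP ->.
  rewrite leq_eqVlt => /orP[/eqP ->//|]; rewrite ltnS => kn /=.
  by rewrite ifN ?IH// neq_ltn ltnS kn.
have GS n : G n.+1 n.+1 = nxt (n, G n) by rewrite /= eqxx.
have PG n : P n (G n).
  elim: n => [|n IH]; first exact: Hx0.
  apply: (Hnxt (n, G n) IH (G n.+1) _ (GS n)).1 => k kn /=.
  by rewrite ifN// neq_ltn ltnS kn.
pose f k := G k k; exists f.
have fG n k : (k <= n)%N -> f k = G n k by move=> kn; rewrite /f -(GE n).
have H n : P n.+1 f /\ Q n f.
  exact: (Hnxt (n, G n) (PG n) f (fG n) (GS n)).
by case=> [|n]; split; [exact: Hx0|case: (H 0%N)|case: (H n)|case: (H n.+1)].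
Qed.

Section Construction.
Context {R : realType} {d : nat}.
Variables (FF : set 'rV[R]_d) (O : nat -> set 'rV[R]_d).
(** The request treated at step [n]: a stage and a rational interval in which its surviving set
    should receive a new piece. *)
Variable code : nat -> nat * (rat * rat).
Hypothesis O_open : forall n, open (O n).
Hypothesis O_dense : forall n U, portion FF U -> U `&` (O n `&` FF) !=set0.
Local Notation mu := (@lebesgue_measure R).
Local Notation negl := (mu.-negligible).

(* Stage [n] splices a piece into the curve near [ncen]: it follows the piece
   for [|s - ncen| <= nin] and changes the curve for [|s - ncen| < nout] only.
   On the piece the chords have slopes within [nrad] of [ndir], also at all later
   stages; [nset] is a set of parameters at which the piece lies in [FF] and
   [npor], and [nbud] bounds how much of it later stages may destroy. *)
Record node := Node {
  ncur : R -> 'rV[R]_d; ncen : R; nin : R; nout : R; ndir : 'rV[R]_d; nrad : R;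
  npor : set 'rV[R]_d; nset : set R; nbud : R }.

Implicit Type f : nat -> node.

(** The part of [nset (f i)] on which no later stage up to [n] has changed the curve. *)
Definition live f n i : set R := [set s | nset (f i) s /\
  forall j, (i < j <= n)%N -> nout (f j) <= `|s - ncen (f j)|].

(** Stated for all sequences of balls, so that it can be fixed before the later stages are known. *)
Definition budget (x : node) := forall c h : nat -> R,
  (forall j, h j <= nbud x * 2^-1 ^+ j) ->
  ~ negl (nset x `\` \bigcup_j [set s | `|s - c j| < h j]).

(** The positive slack [sg] leaves room for the next perturbation. By [inv_nest] the slope ball of
    stage [i] lies inside that of every stage [k] whose inner interval contains a live point of [i];
    this lets a piece refining stage [i] respect all the slopes prescribed around it. *)
Record stage_inv n f : Prop := Inv {
  inv_slack : exists sg : R, [/\ 0 < sg, slopes_in (ncur (f n)) 0 1 0 (1 - sg) &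
    forall i, (i <= n)%N -> slopes_in (ncur (f n)) (ncen (f i) - nin (f i))
      (ncen (f i) + nin (f i)) (ndir (f i)) (nrad (f i) - sg)];
  inv_node : forall i, (i <= n)%N -> [/\ 0 < nin (f i), 0 < nrad (f i),
    open (npor (f i)) & hereditary FF (npor (f i)) (ndir (f i)) (nrad (f i) / 8)];
  inv_dir : forall i, (i <= n)%N -> enorm (ndir (f i)) = 1;
  inv_budget : forall i, (i <= n)%N -> 0 < nbud (f i) /\ budget (f i);
  inv_set : forall i, (i <= n)%N -> forall s, nset (f i) s ->
    `|s - ncen (f i)| < nin (f i);
  inv_live : forall i, (i <= n)%N -> forall s, live f n i s ->
    npor (f i) (ncur (f n) s) /\ FF (ncur (f n) s);
  inv_nest : forall i k, (i <= n)%N -> (k <= n)%N -> forall s, live f n i s ->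
    `|s - ncen (f k)| <= nin (f k) ->
    enorm (ndir (f i) - ndir (f k)) + nrad (f i) <= nrad (f k);
  inv_root : forall i, (i <= n)%N -> forall s, nset (f i) s ->
    `|s - ncen (f 0%N)| < nin (f 0%N);
  inv_itv : 0 < ncen (f 0%N) - nin (f 0%N) /\ ncen (f 0%N) + nin (f 0%N) < 1;
  inv_out : forall i j, (i < j)%N -> (j <= n)%N ->
    nout (f j) <= nbud (f i) * 2^-1 ^+ j;
  inv_deriv : negl [set s | unit_interval s /\
    ~ exists v, deriv_within (@unit_interval R) (ncur (f n)) s v] }.

(** [rel_dist] makes the displacement small relative to [nout], which yields differentiability
    almost everywhere. [rel_sep] protects the endpoints of earlier inner intervals. [rel_open] and
    [rel_point] concern a ball that will contain the limit curve over the whole inner interval.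
    [rel_fair] yields density of the new pieces. *)
Record stage_rel n f : Prop := Rel {
  rel_eq : forall s, nout (f n.+1) <= `|s - ncen (f n.+1)| ->
    ncur (f n.+1) s = ncur (f n) s;
  rel_dist : forall s,
    enorm (ncur (f n.+1) s - ncur (f n) s) <= nout (f n.+1) * 2^-1 ^+ n;
  rel_in : 0 < nin (f n.+1) < nout (f n.+1);
  rel_out : nout (f n.+1) <= 2^-1 ^+ n;
  rel_sep : forall i, (i <= n)%N ->
    (forall s, `|s - ncen (f n.+1)| < nout (f n.+1) ->
       `|s - ncen (f i)| < nin (f i)) \/
    (forall s, `|s - ncen (f n.+1)| < nout (f n.+1) ->
       nin (f i) < `|s - ncen (f i)|);
  rel_root : forall s, `|s - ncen (f n.+1)| < nout (f n.+1) ->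
    `|s - ncen (f 0%N)| < nin (f 0%N);
  rel_open : forall y,
    enorm (y - ncur (f n.+1) (ncen (f n.+1) - nin (f n.+1))) <= 2 * nin (f n.+1) ->
    O n y;
  rel_point : exists2 y, FF y &
    enorm (y - ncur (f n.+1) (ncen (f n.+1) - nin (f n.+1))) <= 2 * nin (f n.+1);
  rel_rad : nrad (f n.+1) <= 2^-1 ^+ n;
  rel_fair : ((code n).1 <= n)%N -> ~ negl (live f n (code n).1 `&` qitv (code n).2) ->
    forall s, `|s - ncen (f n.+1)| <= nin (f n.+1) -> qitv (code n).2 s }.

Lemma inv_root_itv n f s : stage_inv n f ->
  `|s - ncen (f 0%N)| <= nin (f 0%N) -> 0 < s < 1.
Proof. by move=> /inv_itv[? ?]; rewrite ler_distl; lra. Qed.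

Lemma live_posm n f i : stage_inv n f -> (i <= n)%N -> ~ negl (live f n i).
Proof.
move=> If le_in; have [b0 bP] := inv_budget If le_in.
apply: (posm_avoid bP b0 (P := fun j => (i < j <= n)%N)) => j /andP[ij jn].
exact: (inv_out If).
Qed.

(** A request is served if its stage already exists and its set has positive measure; otherwise the
    live set of stage [0], on the whole line, is the default target. *)
Lemma choose_target n f : stage_inv n f -> exists p (Q : set R), [/\ (p <= n)%N, open Q,
  ~ negl (live f n p `&` Q) &
  ((code n).1 <= n)%N -> ~ negl (live f n (code n).1 `&` qitv (code n).2) ->
    Q `<=` qitv (code n).2].
Proof.
move=> If.
have [[le nn]|H] := pselect (((code n).1 <= n)%N /\
    ~ negl (live f n (code n).1 `&` qitv (code n).2)).
  have oq : open (@qitv R (code n).2).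
    rewrite (_ : qitv _ = `]ratr (code n).2.1, ratr (code n).2.2[%classic).
      exact: interval_open.
    by apply/seteqP; split => s /=; rewrite in_itv.
  by exists (code n).1, (qitv (code n).2); split=> // _ _ s.
exists 0%N, setT; split=> //; [exact: openT| |by move=> ? ?; case: H].
by rewrite setIT; exact: live_posm.
Qed.

(** A set of positive measure has a point [t] off the countably many endpoints of inner intervals. A
    small [h] then keeps the outer interval on one side of each of the finitely many existing
    endpoints. *)
Lemma choose_center n f : stage_inv n f -> exists p t (h : R), [/\ (p <= n)%N, live f n p t,
  0 < h <= 2^-1 ^+ n,
  forall k, (k <= n)%N -> h <= nbud (f k) * 2^-1 ^+ n.+1 /\
    ((forall s, `|s - t| < h -> `|s - ncen (f k)| < nin (f k)) \/
     (forall s, `|s - t| < h -> nin (f k) < `|s - ncen (f k)|)) &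
  ((code n).1 <= n)%N -> ~ negl (live f n (code n).1 `&` qitv (code n).2) ->
    forall s, `|s - t| < h -> qitv (code n).2 s].
Proof.
move=> If; have [p [Q [pn oQ nQ fair]]] := choose_target If.
pose B : set R := \bigcup_k
  ([set ncen (f k) - nin (f k)] `|` [set ncen (f k) + nin (f k)]).
have nB : negl B.
  by apply: negligible_bigcup => k; apply: negligibleU; exact: negl_point.
have [t [[lt Qt] Bt]] := posm_nonempty (posm_setD nQ nB).
have [hQ hQ0 HQ] : exists2 e : R, 0 < e & forall s, `|s - t| < e -> Q s.
  have /nbhs_ballP[e /= e0 eU] := open_nbhs_nbhs (conj oQ Qt).
  by exists e => // s st; apply: eU; rewrite /ball/= distrC.
have [h0 h00 Hh0] : exists2 e : R, 0 < e & forall k, (k <= n)%N ->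
    forall h, 0 < h <= e -> h <= nbud (f k) * 2^-1 ^+ n.+1 /\
    ((forall s, `|s - t| < h -> `|s - ncen (f k)| < nin (f k)) \/
     (forall s, `|s - t| < h -> nin (f k) < `|s - ncen (f k)|)).
  apply: finite_min.
  move=> k kn; have [b0 _] := inv_budget If kn.
  have bp : 0 < nbud (f k) * 2^-1 ^+ n.+1 by rewrite mulr_gt0// exprn_gt0.
  have tk : `|t - ncen (f k)| != nin (f k).
    apply/eqP => tk; apply: Bt; exists k => //.
    have [tc|tc] := leP (ncen (f k)) t.
      by right => /=; move: tk; rewrite ger0_norm; lra.
    by left => /=; move: tk; rewrite ltr0_norm; lra.
  pose e : R := `| `|t - ncen (f k)| - nin (f k)|.
  have e0 : 0 < e by rewrite normr_gt0 subr_eq0.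
  exists (Num.min (nbud (f k) * 2^-1 ^+ n.+1) e); first by rewrite lt_min bp.
  move=> e'; rewrite le_min => /and3P[e'0 e'b e'e]; split=> //.
  have [tk'|tk'] := ltP `|t - ncen (f k)| (nin (f k)).
    left => s st; have := ler_normD (s - t) (t - ncen (f k)).
    have eE : e = - (`|t - ncen (f k)| - nin (f k)) by rewrite /e ltr0_norm//; lra.
    by rewrite addrA subrK; lra.
  right => s st; have := ler_normD (t - s) (s - ncen (f k)).
  have eE : e = `|t - ncen (f k)| - nin (f k) by rewrite /e ger0_norm// subr_ge0.
  by rewrite addrA subrK (distrC t s); lra.
pose h := Num.min h0 (Num.min (2^-1 ^+ n) hQ).
have h1 : h <= h0 by rewrite ge_min lexx.
have h2 : h <= 2^-1 ^+ n by rewrite !ge_min lexx orbT.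
have h3 : h <= hQ by rewrite !ge_min lexx !orbT.
have hp : 0 < h by rewrite !lt_min h00 hQ0 exprn_gt0.
exists p, t, h; split=> //; first by rewrite hp.
  by move=> k kn; apply: Hh0 => //; rewrite hp.
by move=> le nn s st; apply: fair => //; apply: HQ; lra.
Qed.

Lemma portionI_eball n U x e : portion FF U -> U x -> FF x -> 0 < e ->
  portion FF (U `&` [set y | enorm (y - x) < e] `&` O n).
Proof.
move=> [oU _] Ux Fx e0.
have pV : portion FF (U `&` [set y | enorm (y - x) < e]).
  split; first by apply: openI => //; exact: open_eball.
  by exists x; split=> //; split=> //=; rewrite subrr enorm0.
split; first by apply: openI => //; case: pV.
by have [y [Vy [Oy Fy]]] := O_dense n pV; exists y.
Qed.

(** The order of choices matters: first the admissible displacement [eta], then a refined direction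
    on a portion near the current point and inside [O n], and last the length [tau] of the piece. *)
Lemma choose_piece n f p t (h sg : R) : stage_inv n f -> (p <= n)%N -> live f n p t ->
  0 < h -> 0 < sg -> exists tau nu sg' u e U eta,
  [/\ [/\ 0 < tau, tau <= h / 2, 0 < sg', enorm u = 1 &
        0 < e /\ 8 * e <= 2^-1 ^+ n],
     [/\ enorm (u - ndir (f p)) + 8 * e <= nrad (f p), open U, hereditary FF U u e,
        slopes_in nu (- tau) tau u (8 * e - sg') & slopes_in nu (- tau) tau 0 (1 - sg')],
     ~ negl [set s | `|s| < tau /\ (U `&` FF) (nu s)] /\
     (forall s, `|s| < tau -> exists v, deriv_within [set: R] nu s v),
     forall y, enorm (y - nu (- tau)) <= 2 * tau -> O n y &
     [/\ 0 < eta, eta <= h * 2^-1 ^+ n, eta <= h * (sg / 4), 3 * tau + eta / 4 <= eta &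
       exists2 x, `|x| < tau & FF (nu x) /\ enorm (nu x - ncur (f n) t) < eta / 4]].
Proof.
move=> If pn lt h0 sg0.
have [tau0 r0 oU hU] := inv_node If pn.
have [Ut Ft] := inv_live If pn lt.
(* The first bound serves [rel_dist]; the second makes the fading cost at most half of the slack
   [sg]. *)
pose eta : R := h * Num.min (2^-1 ^+ n) (sg / 4).
have z0 : 0 < 2^-1 ^+ n :> R by rewrite exprn_gt0.
have eta0 : 0 < eta by rewrite mulr_gt0// lt_min z0; lra.
have eta1 : eta <= h * 2^-1 ^+ n by rewrite ler_pM2l// ge_min lexx.
have eta2 : eta <= h * (sg / 4) by rewrite ler_pM2l// ge_min lexx orbT.
(* The refined direction is within [nrad (f p) / 8 + e] of the old one; adding the new radius
   [8 * e] stays below [nrad (f p)]. *)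
pose e : R := Num.min (nrad (f p)) (2^-1 ^+ n) / 16.
have e0 : 0 < e by rewrite divr_gt0// lt_min r0.
have e1 : 16 * e <= nrad (f p) by rewrite mulrC divfK// ge_min lexx.
have e2 : 16 * e <= 2^-1 ^+ n by rewrite mulrC divfK// ge_min lexx orbT.
have pU : portion FF (npor (f p)) by split=> //; exists (ncur (f n) t).
have eta4 : 0 < eta / 4 by lra.
have pV := portionI_eball n pU Ut Ft eta4.
set V := _ `&` O n in pV.
have hV : hereditary FF V (ndir (f p)) (nrad (f p) / 8).
  by apply: hereditaryS hU => y [[]].
have [U' [u [pU' U'V u1 uu hU']]] := hereditary_refine pV hV e0.
have [oU' [y0 [U'y0 Fy0]]] := pU'.
have [rho rho0 Hrho] := open_enorm (@O_open n) (U'V _ U'y0).2.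
pose U2 := U' `&` [set y | enorm (y - y0) < rho / 2].
have pU2 : portion FF U2.
  split; first by apply: openI => //; exact: open_eball.
  by exists y0; split=> //; split=> //=; rewrite subrr enorm0; lra.
have hU2 : hereditary FF U2 u e by apply: hereditaryS hU' => y [].
(* The three bounds leave room for the ramp, give [3 * tau + eta / 4 <= eta], and keep the ball of
   radius [2 * tau] around [nu (- tau)] within [rho] of [y0]. *)
pose tau1 := Num.min (h / 2) (Num.min (eta / 8) (rho / 16)).
have tau10 : 0 < tau1 by rewrite !lt_min; lra.
have [tau [nu [sg' [/andP[tp tau1P] sg'0 sn1 sn2 [nN dn]]]]] :=
  hits_piece e0 tau10 u1 (hU2 _ pU2 (fun _ H => H)).
have t1 : tau <= h / 2 by apply: le_trans tau1P _; rewrite ge_min lexx.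
have t2 : tau <= eta / 8 by apply: le_trans tau1P _; rewrite !ge_min lexx orbT.
have t3 : tau <= rho / 16 by apply: le_trans tau1P _; rewrite !ge_min lexx !orbT.
have [x [xtau [[U'x xy0] Fx]]] := posm_nonempty nN.
exists tau, nu, sg', u, e, U2, eta; split=> //.
- by split=> //; split=> //; lra.
- by split=> //; [lra|case: pU2].
- move=> y yn; apply: Hrho.
  have := enorm_trans (nu (- tau)) y y0; have := enorm_trans (nu x) (nu (- tau)) y0.
  have sn3 : slopes_in nu (- tau) tau 0 1 by apply: slopes_in_le sn2; lra.
  have := (@slopes_in0 _ _ nu (- tau) tau 1).2 sn3 (- tau) x.
  move: xtau xy0 => /=; rewrite ltr_norml => /andP[x1 x2] xy0.
  rewrite ler0_norm; last lra.
  by move=> /(_ ltac:(lra) ltac:(lra)); lra.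
- split=> //; first lra.
  exists x => //; split=> //; by have [[_ /=]] := U'V _ U'x.
Qed.

End Construction.

(** * Quantitative bounds for one splice *)

Section SpliceBounds.
Context {R : realType} {d : nat}.
Implicit Types (g nu : R -> 'rV[R]_d) (u v w : 'rV[R]_d).

Lemma enorm_ball_trans v u w (a b c : R) : enorm (u - v) + a <= b ->
  enorm (v - w) + b <= c -> enorm (u - w) + a <= c.
Proof. by have := enorm_trans v u w; lra. Qed.

Lemma lipschitz_near g nu (t tau a x1 : R) : slopes_in g 0 1 0 1 ->
  slopes_in nu (- tau) tau 0 1 -> `|x1| < tau -> enorm (nu x1 - g t) <= a ->
  (forall x, `|x| <= tau -> 0 <= t + x <= 1) ->
  forall x, `|x| <= tau -> enorm (nu x - g (t + x)) <= 3 * tau + a.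
Proof.
move=> sg sn x1t x1a tau01 x xt.
have t0 : 0 <= tau by exact: le_trans (normr_ge0 x) xt.
have t01 : 0 <= t <= 1 by rewrite -[t]addr0; apply: tau01; rewrite normr0.
have H1 : enorm (nu x - nu x1) <= 1 * `|x - x1|.
  apply: (@slopes_in0 _ _ nu (- tau) tau 1).2 => //; rewrite -ler_norml//.
  exact: ltW.
have H2 : enorm (g t - g (t + x)) <= 1 * `|t - (t + x)|.
  by apply: (@slopes_in0 _ _ g 0 1 1).2 => //; exact: tau01.
have := enorm_trans (nu x1) (nu x) (g (t + x)).
have := enorm_trans (g t) (nu x1) (g (t + x)).
have := ler_normB x x1; move: H2.
by rewrite opprD addrA subrr sub0r normrN; lra.
Qed.

(** Since [h - tau >= h / 2], the perturbation [eta / (h - tau)] is at most [sg / 2], and half of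
    the slack remains. *)
Lemma splice_slopes_slack g nu (t tau h sg m eta a b : R) w r :
  0 < tau -> tau <= h / 2 -> 0 < sg -> eta <= h * (sg / 4) -> m <= sg / 2 ->
  (forall x, `|x| <= tau -> enorm (nu x - g (t + x)) <= eta) ->
  a <= t - tau -> t + tau <= b ->
  slopes_in g a b w (r - sg) -> slopes_in nu (- tau) tau w (r - m) ->
  slopes_in (splice g nu t tau h) a b w (r - m).
Proof.
move=> t0 th sg0 eh ms H at_ tb sg' sn.
have tauh : 0 < tau < h by lra.
apply: (splice_slopes tauh H at_ tb sg' sn).
suff : eta / (h - tau) <= sg / 2 by lra.
by rewrite ler_pdivrMr; nra.
Qed.

Lemma splice_slopes_in g nu (t tau h : R) w r : 0 < tau < h ->
  slopes_in nu (- tau) tau w r ->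
  slopes_in (splice g nu t tau h) (t - tau) (t + tau) w r.
Proof.
move=> th sn s s' st s't; rewrite !(splice_in th) ?ler_distl//.
have := sn (s - t) (s' - t).
by rewrite (_ : s - t - (s' - t) = s - s'); [apply; lra|ring].
Qed.

End SpliceBounds.

(** * The inductive step *)

Section Step.
Context {R : realType} {d : nat}.
Variables (FF : set 'rV[R]_d) (O : nat -> set 'rV[R]_d).
Variable code : nat -> nat * (rat * rat).
Hypothesis O_open : forall n, open (O n).
Hypothesis O_dense : forall n U, portion FF U -> U `&` (O n `&` FF) !=set0.
Local Notation mu := (@lebesgue_measure R).
Local Notation negl := (mu.-negligible).
Implicit Type f : nat -> @node R d.

Lemma step n f : stage_inv FF n f -> exists x, forall f',
  (forall k, (k <= n)%N -> f' k = f k) -> f' n.+1 = x ->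
  stage_inv FF n.+1 f' /\ stage_rel FF O code n f'.
Proof.
move=> If.
have [sg [sg0 slg slk]] := inv_slack If.
have [p [t [h [pn lt /andP[h0 hn] Hk fair]]]] := choose_center code If.
have [tau [nu [sg' [u [e [U [eta [[tau0 tauh2 sg'0 u1 [e0 e1]]
  [nest oU hU sn1 sn2] [nN dn] HO
  [eta0 eta1 eta2 eta3 [x1 x1t [Fx1 x1d]]]]]]]]]]] :=
  choose_piece O_open O_dense If pn lt h0 sg0.
set g := ncur (f n) in slg slk x1d.
have tauh : tau < h by apply: le_lt_trans tauh2 _; rewrite ltr_pdivrMr// ltr_pMr// ltr1n.
have th : 0 < tau < h by rewrite tau0.
pose S := [set s | `|s - t| < tau /\ (U `&` FF) (nu (s - t))].
have nS : ~ negl S.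
  move=> nS; apply: nN; apply: negligibleS (negl_affine t ltr01 nS) => s Us.
  by rewrite /S/= mul1r addrK.
have [b b0 bP] := posm_budget nS.
have tt0 : `|t - t| < h by rewrite subrr normr0.
(* The outer interval cannot lie outside the root interval, because its centre [t] is a live
   point. *)
have W0 s : `|s - t| < h -> `|s - ncen (f 0%N)| < nin (f 0%N).
  have [_ [H|H]] := Hk 0%N (leq0n n); first exact: H.
  by have := lt_trans (H t tt0) (inv_root If pn lt.1); rewrite ltxx.
have W01 s : `|s - t| < h -> 0 < s < 1 by move=> /W0/ltW; exact: (inv_root_itv If).
have sn3 : slopes_in nu (- tau) tau 0 1.
  by apply: slopes_in_le sn2; rewrite gerBl ltW.
have eps x : `|x| <= tau -> enorm (nu x - g (t + x)) <= eta.
  move=> xt; apply: le_trans eta3.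
  apply: (lipschitz_near _ sn3 x1t (ltW x1d)) => // [|y yt].
    by apply: slopes_in_le slg; rewrite gerBl ltW.
  have /W01/andP[] : `|t + y - t| < h by rewrite addrAC subrr add0r (le_lt_trans yt).
  by move=> /ltW -> /ltW ->.
have tl : `|t - tau - t| < h by rewrite addrAC subrr sub0r normrN gtr0_norm.
have tr : `|t + tau - t| < h by rewrite addrAC subrr add0r gtr0_norm.
pose G := splice g nu t tau h.
(* The new slack: at most half of the old one, and at most that of the inserted piece. *)
have [m [m0 m1 m2]] : exists m : R, [/\ 0 < m, m <= sg / 2 & m <= sg'].
  exists (Num.min (sg / 2) sg').
  by rewrite lt_min !ge_min !lexx orbT divr_gt0.
have nestk k : (k <= n)%N -> `|t - ncen (f k)| <= nin (f k) ->
    enorm (u - ndir (f k)) + 8 * e <= nrad (f k).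
  by move=> kn /(inv_nest If pn kn lt); exact: enorm_ball_trans nest.
have sn4 : slopes_in nu (- tau) tau u (8 * e - m).
  by apply: slopes_in_le sn1; rewrite lerD2l lerN2.
(* Either the splice takes place inside the inner interval of [k], where the nested slope balls
   apply, or it does not touch that interval. *)
have GW k : (k <= n)%N -> slopes_in G (ncen (f k) - nin (f k))
    (ncen (f k) + nin (f k)) (ndir (f k)) (nrad (f k) - m).
  move=> kn; have [_ [H|H]] := Hk k kn.
    have := H _ tl; have := H _ tr; rewrite !ltr_distl => /andP[_ /ltW Hr] /andP[/ltW Hl _].
    apply: (splice_slopes_slack tau0 tauh2 sg0 eta2 m1 eps Hl Hr); first exact: slk.
    by apply: slopes_in_ball sn4; rewrite addrA lerD2r; exact: nestk (ltW (H t tt0)).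
  apply: (@slopes_in_eq _ _ g).
    move=> s sk; rewrite /G splice_out// leNgt; apply/negP => /H.
    by rewrite ltNge ler_distl sk.
  apply: slopes_in_le (slk k kn); rewrite lerD2l lerN2.
  by apply: le_trans m1 _; rewrite ler_pdivrMr// ler_pMr// ler1n.
have G01 : slopes_in G 0 1 0 (1 - m).
  have /andP[/ltW Hl _] := W01 _ tl; have /andP[_ /ltW Hr] := W01 _ tr.
  apply: (splice_slopes_slack tau0 tauh2 sg0 eta2 m1 eps Hl Hr) => //.
  by apply: slopes_in_le sn2; rewrite lerD2l lerN2.
have Gnew : slopes_in G (t - tau) (t + tau) u (8 * e - m) by exact: splice_slopes_in.
have Gend : G (t - tau) = nu (- tau).
  by rewrite /G (splice_in th) addrAC subrr sub0r// normrN gtr0_norm.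
have dG s : enorm (G s - g s) <= h * 2^-1 ^+ n.
  by apply: le_trans eta1; exact: splice_dist.
clear sn4 eps tl tr slg slk m1 m2 eta2 eta3 sn1 sn2 x1d sg0 sg'0.
(* The radius is [8 * e] because [inv_node] asks for heredity with an eighth of the radius. *)
exists (Node G t tau h u (8 * e) U S b) => f' fE fx.
have f0 := fE 0%N (leq0n n).
have fn := fE n (leqnn n).
have cases i : (i <= n.+1)%N -> (i <= n)%N \/ i = n.+1.
  by rewrite leq_eqVlt ltnS => /orP[/eqP|]; [right|left].
have liveS i s : (i <= n)%N -> live f' n.+1 i s -> live f n i s /\ h <= `|s - t|.
  move=> ile [ns H]; split.
    split; first by rewrite -fE.
    move=> j /andP[ij jn]; rewrite -(fE j)//; apply: H.
    by rewrite ij leqW.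
  by have := H n.+1; rewrite fx /= ltnS ile leqnn; apply.
have liveE i : (i <= n)%N -> live f' n i = live f n i.
  move=> ile; apply/seteqP; split=> s [ns H]; split.
  - by rewrite -fE.
  - by move=> j /[dup] ijn /andP[ij jn]; rewrite -(fE j)//; apply: H.
  - by rewrite fE.
  - by move=> j /[dup] ijn /andP[ij jn]; rewrite (fE j)//; apply: H.
have liveN s : live f' n.+1 n.+1 s -> S s by move=> []; rewrite fx.
split; split.
- exists m; rewrite fx; split=> // i /cases[il|->].
    by rewrite (fE _ il); exact: GW.
  by rewrite fx.
- move=> i /cases[il|->]; first by rewrite (fE _ il); exact: (inv_node If).
  by rewrite fx /=; split=> //; [rewrite mulr_gt0|rewrite mulrC mulKf].
- move=> i /cases[il|->]; first by rewrite (fE _ il); exact: (inv_dir If).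
  by rewrite fx.
- move=> i /cases[il|->]; first by rewrite (fE _ il); exact: (inv_budget If).
  by rewrite fx.
- move=> i /cases[il|->]; first by rewrite (fE _ il); exact: (inv_set If).
  by rewrite fx => s [].
- move=> i /cases[il|->] s.
    move=> /(liveS _ _ il)[ls hs]; rewrite (fE _ il) fx /= /G splice_out//.
    exact: (inv_live If).
  by move=> /liveN[st Us]; rewrite fx /= /G splice_in// ltW.
- move=> i k /cases[il|->] /cases[kl|->] s.
  + by move=> /(liveS _ _ il)[ls _]; rewrite (fE _ il) (fE _ kl); exact: (inv_nest If).
  + move=> /(liveS _ _ il)[_ hs]; rewrite fx /= => /(le_trans hs).
    by rewrite leNgt tauh.
  + move=> /liveN[st _]; rewrite (fE _ kl) fx /= => sk; apply: nestk => //.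
    have [_ [H|H]] := Hk k kl; first exact/ltW/H.
    by have := H s (lt_trans st tauh); rewrite ltNge sk.
  + by rewrite fx /= subrr enorm0 add0r.
- move=> i /cases[il|->] s; first by rewrite (fE _ il) f0; exact: (inv_root If).
  by rewrite fx f0 => -[st _]; apply: W0; exact: lt_trans tauh.
- by rewrite f0; exact: (inv_itv If).
- move=> i j ij /cases[jl|jn].
    have il : (i <= n)%N by apply: leq_trans jl; exact: ltnW.
    by rewrite (fE _ jl) (fE _ il); exact: (inv_out If).
  have il : (i <= n)%N by rewrite -ltnS -jn.
  by rewrite jn fx (fE _ il) /=; case: (Hk i il).
- rewrite fx /=.
  have nP (a c : R) : negl ([set a] `|` [set c]) by apply: negligibleU; exact: negl_point.
  apply: negligibleS (negligibleU (inv_deriv If)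
    (negligibleU (nP (t - h) (t - tau)) (nP (t + tau) (t + h)))) => s [us nd].
  have [H|H] := pselect (exists v, deriv_within (@unit_interval R) g s v); last by left.
  right; apply: contrapT => ns; apply: nd; apply: splice_deriv => //.
  + by apply/eqP => E; apply: ns; left; left.
  + by apply/eqP => E; apply: ns; left; right.
  + by apply/eqP => E; apply: ns; right; left.
  + by apply/eqP => E; apply: ns; right; right.
- by rewrite fx fn /= => s; exact: splice_out.
- rewrite fx fn /= => s; exact: dG.
- by rewrite fx.
- by rewrite fx.
- by move=> i il; rewrite fx (fE _ il) /=; case: (Hk i il).
- by rewrite fx f0.
- by rewrite fx /= Gend; exact: HO.
- exists (nu x1) => //; rewrite fx /= Gend.
  have /andP[x1l x1r] : - tau < x1 < tau by rewrite -ltr_norml.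
  have H1 : enorm (nu x1 - nu (- tau)) <= 1 * `|x1 - - tau|.
    apply: (@slopes_in0 _ _ nu (- tau) tau 1).2 => //.
      by rewrite (ltW x1l) ltW.
    by rewrite lexx ge0_cp// ltW.
  apply: le_trans H1 _; rewrite mul1r opprK ger0_norm.
    by rewrite mulr_natl mulr2n lerD2r ltW.
  by rewrite -[tau]opprK subr_ge0 ltW.
- by rewrite fx.
- rewrite fx /= => cn; rewrite liveE// => nn s st; apply: fair => //.
  exact: le_lt_trans tauh.
Qed.

End Step.

(** * The limit curve *)

Section Limit.
Context {R : realType} {d : nat}.
Variables (FF : set 'rV[R]_d) (O : nat -> set 'rV[R]_d).
Variable code : nat -> nat * (rat * rat).
Variable f : nat -> @node R d.
Hypothesis fI : forall n, stage_inv FF n f.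
Hypothesis fR : forall n, stage_rel FF O code n f.
Hypothesis code_inf : forall x n, exists2 m, (n <= m)%N & code m = x.
Hypothesis FF_closed : closed FF.
Hypothesis O_decr : forall m n, (m <= n)%N -> O n `<=` O m.
Local Notation mu := (@lebesgue_measure R).
Local Notation negl := (mu.-negligible).
Local Notation g n := (ncur (f n)).
Local Notation c n := (ncen (f n)).
Local Notation tau n := (nin (f n)).
Local Notation h n := (nout (f n)).

Lemma half_pow_gt0 n : 0 < 2^-1 ^+ n :> R.
Proof. by rewrite exprn_gt0. Qed.

Lemma half_powS n : 2^-1 ^+ n.+1 = 2^-1 ^+ n / 2 :> R.
Proof. by rewrite exprS mulrC. Qed.

Lemma half_pow_small (e : R) : 0 < e -> exists n, 2^-1 ^+ n < e.
Proof.
move=> e0; have : (fun n => 2^-1 ^+ n) @ \oo --> (0 : R).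
  by apply: cvg_expr; rewrite gtr0_norm ?invr_gt0// invf_lt1// ltr1n.
move=> /cvgrPdist_lt/(_ e e0)[m _ /(_ m (leqnn _))].
rewrite sub0r normrN => H; exists m.
by apply: le_lt_trans H; exact: ler_norm.
Qed.

Lemma half_pow_le m n : (m <= n)%N -> 2^-1 ^+ n <= 2^-1 ^+ m :> R.
Proof.
move=> mn; rewrite -(subnK mn) exprD.
apply: ler_piMl; first exact/ltW/half_pow_gt0.
by rewrite exprn_ile1// invf_le1// ler1n.
Qed.

Lemma stage_dist s (a : R) n : (forall j, (n <= j)%N ->
    enorm (g j.+1 s - g j s) <= a * 2^-1 ^+ j) -> 0 <= a ->
  forall m, (n <= m)%N -> enorm (g m s - g n s) <= 2 * a * 2^-1 ^+ n.
Proof.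
move=> H a0.
suff K k : enorm (g (n + k)%N s - g n s) <=
    2 * a * (2^-1 ^+ n - 2^-1 ^+ (n + k)).
  move=> m nm; rewrite -(subnKC nm); apply: le_trans (K _) _.
  by apply: ler_wpM2l; [rewrite mulr_ge0|rewrite gerBl ltW ?half_pow_gt0].
elim: k => [|k IH]; first by rewrite addn0 !subrr enorm0 mulr0.
rewrite addnS half_powS.
have := enorm_trans (g (n + k)%N s) (g (n + k).+1 s) (g n s).
have := H (n + k)%N (leq_addr _ _).
by move: (2^-1 ^+ (n + k)) IH => z IH; lra.
Qed.

Lemma stage_step1 s j : enorm (g j.+1 s - g j s) <= 1 * 2^-1 ^+ j.
Proof.
apply: le_trans (rel_dist (fR j) s) _.
apply: ler_wpM2r; first exact/ltW/half_pow_gt0.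
apply: le_trans (rel_out (fR j)) _.
by rewrite exprn_ile1// invf_le1// ler1n.
Qed.

Lemma limit_curve : exists gam : R -> 'rV[R]_d, forall s (e : R), 0 < e ->
  exists n1, forall n, (n1 <= n)%N -> enorm (g n s - gam s) <= e.
Proof.
have /choice[gam H] : forall s, exists y, forall n,
    enorm (g n s - y) <= d%:R * (2 * 2^-1 ^+ n).
  move=> s; apply: (@enorm_cauchy _ _ (fun n => g n s)) => k l.
  have K m n : (n <= m)%N -> enorm (g m s - g n s) <= 2 * 2^-1 ^+ n.
    by move=> nm; have := @stage_dist s 1 n (fun j _ => stage_step1 s j) ler01 m nm;
      rewrite mulr1.
  have := half_pow_gt0 k; have := half_pow_gt0 l.
  have [kl|/ltnW lk] := leqP k l.
    by rewrite enormB; have := K l k kl; lra.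
  by have := K k l lk; lra.
exists gam => s e e0.
have d0 : 0 < d%:R * 2 + 1 :> R by rewrite ltr_wpDl// mulr_ge0.
have [m hm] := half_pow_small (divr_gt0 e0 d0).
exists m => n mn; apply: le_trans (H s n) _.
rewrite mulrA.
have : 2^-1 ^+ n <= e / (d%:R * 2 + 1) by apply: le_trans (half_pow_le mn) _; exact: ltW.
rewrite ler_pdivlMr// => ?; have := half_pow_gt0 n; lra.
Qed.

Variable gam : R -> 'rV[R]_d.
Hypothesis gam_lim : forall s (e : R), 0 < e ->
  exists n1, forall n, (n1 <= n)%N -> enorm (g n s - gam s) <= e.

Lemma gam_lipschitz : slopes_in gam 0 1 0 1.
Proof.
apply: (slopes_in_lim (n0 := 0%N) gam_lim) => n _.
by have [sg [sg0 sl _]] := inv_slack (fI n); apply: slopes_in_le sl; lra.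
Qed.

Lemma gam_slopes i : slopes_in gam (c i - tau i) (c i + tau i) (ndir (f i)) (nrad (f i)).
Proof.
apply: (slopes_in_lim (n0 := i) gam_lim) => n /= le_in.
by have [sg [sg0 _ sl]] := inv_slack (fI n); apply: slopes_in_le (sl i le_in); lra.
Qed.

Lemma gam_stable n s : (forall j, (n < j)%N -> h j <= `|s - c j|) -> gam s = g n s.
Proof.
move=> H.
have E m : (n <= m)%N -> g m s = g n s.
  move=> nm; rewrite -(subnKC nm); elim: (m - n)%N => [|k IH]; first by rewrite addn0.
  by rewrite addnS -IH; apply: (rel_eq (fR _)); apply: H; rewrite ltnS leq_addr.
apply/eqP; rewrite -subr_eq0; apply/eqP/enorm_eq0/eqP.
rewrite eq_le enorm_ge0 andbT; apply/ler_addgt0Pr => e e0; rewrite add0r.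
have [n1 H1] := gam_lim s e0.
by have := H1 (maxn n n1) (leq_maxr _ _); rewrite E ?leq_maxl// enormB.
Qed.

Lemma tau_gt0 i : 0 < tau i.
Proof. by case: (inv_node (fI i) (leqnn i)). Qed.

Lemma outer_root i s : `|s - c i.+1| < h i.+1 -> `|s - c 0%N| < tau 0%N.
Proof. exact: (rel_root (fR i)). Qed.

Lemma root_itv s : `|s - c 0%N| <= tau 0%N -> 0 < s < 1.
Proof. exact: (inv_root_itv (fI 0%N)). Qed.

Lemma inner_itv i s : `|s - c i| <= tau i -> 0 < s < 1.
Proof.
case: i => [|i]; first exact: root_itv.
move=> si; apply/root_itv/ltW/(@outer_root i).
by have := rel_in (fR i); lra.
Qed.

Lemma end_dist i : `|c i - tau i - c i| = tau i.
Proof. by rewrite addrAC subrr sub0r normrN gtr0_norm// tau_gt0. Qed.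

(** By [rel_sep] no later outer interval contains an endpoint of an inner interval. *)
Lemma inner_boundary i s : `|s - c i| = tau i -> gam s = g i s.
Proof.
move=> si; apply: gam_stable => -[//|j]; rewrite ltnS => ij.
rewrite leNgt; apply/negP => sj.
by have [H|H] := rel_sep (fR j) ij; have := H s sj; rewrite si ltxx.
Qed.

(** The left endpoint already has its final value, and the limit is 1-Lipschitz on an interval of
    length [2 * tau i]. *)
Lemma gam_inner i s : `|s - c i| <= tau i ->
  enorm (gam s - g i (c i - tau i)) <= 2 * tau i.
Proof.
move=> si; rewrite -(inner_boundary (end_dist i)).
have e1 : `|c i - tau i - c i| <= tau i by rewrite end_dist.
have := inner_itv si; have := inner_itv e1 => h1 h2.
have H : enorm (gam s - gam (c i - tau i)) <= 1 * `|s - (c i - tau i)|.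
  by apply: (@slopes_in0 _ _ gam 0 1 1).2; [exact: gam_lipschitz|lra|lra].
apply: le_trans H _; move: si; rewrite mul1r ler_distl => si.
by rewrite ger0_norm; lra.
Qed.

Definition inner_often : set R :=
  [set t | forall n, exists2 i, (n < i)%N & `|t - c i| < tau i].

(** Over inner interval [i] the limit is within [4 * tau i] of a point of [FF], which is closed, and
    lies in the ball that [rel_open] places in an open set of the sequence. *)
Lemma gam_often t : inner_often t -> FF (gam t) /\ forall n, O n (gam t).
Proof.
move=> ht; split=> [|n].
  apply: closed_enorm => // e e0.
  have [|n hn] := half_pow_small (e := e / 4); first lra.
  have [[//|i]] := ht n; rewrite ltnS => ni /ltW /gam_inner ti.
  have [y Fy yd] := rel_point (fR i); exists y => //.
  have := enorm_trans (g i.+1 (c i.+1 - tau i.+1)) y (gam t).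
  rewrite (enormB (g i.+1 _) (gam t)).
  have := half_pow_le ni; have := rel_out (fR i); have := rel_in (fR i); lra.
have [[//|i]] := ht n; rewrite ltnS => ni /ltW /gam_inner ti.
by apply: (O_decr ni); exact: (rel_open (fR i)).
Qed.

(** By Borel-Cantelli almost every [s] eventually avoids the doubled outer intervals. A later stage
    [j] that moves [x] then has outer radius below [|x - s|], so it moves [x] by at most
    [|x - s| * 2^-j]; the tail sum is negligible against [|x - s|]. *)
Lemma gam_deriv_ae : negl [set s | unit_interval s /\
  ~ exists v, deriv_within (@unit_interval R) gam s v].
Proof.
pose N1 := \bigcup_n [set s | unit_interval s /\
  ~ exists v, deriv_within (@unit_interval R) (g n) s v].
pose N2 := [set s | forall m, exists2 j, (m <= j)%N & `|s - c j.+1| < 2 * h j.+1].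
have n1 : negl N1 by apply: negligible_bigcup => n; exact: (inv_deriv (fI n)).
have n2 : negl N2.
  apply: (@negl_limsup_ball _ (fun j => c j.+1) (fun j => 2 * h j.+1) 2) => // j.
  by have := rel_out (fR j); lra.
apply: negligibleS (negligibleU n1 n2) => s [us nd].
apply: contrapT => /not_orP[sN1 sN2]; apply: nd.
have [m Hm] : exists m, forall j, (m <= j)%N -> 2 * h j.+1 <= `|s - c j.+1|.
  apply: contrapT => H; apply: sN2 => m; apply: contrapT => H'; apply: H.
  exists m => j mj; rewrite leNgt; apply/negP => sj; apply: H'.
  by exists j.
have [v dv] : exists v, deriv_within (@unit_interval R) (g m) s v.
  by apply: contrapT => H; apply: sN1; exists m.
have hgt0 j : 0 < h j.+1 by have := rel_in (fR j); lra.
have far j x : (m <= j)%N -> g j.+1 x = g j x \/ h j.+1 < `|x - s|.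
  move=> mj; have [xj|xj] := leP (h j.+1) `|x - c j.+1|.
    by left; exact: (rel_eq (fR j)).
  right; have := Hm j mj; have := ler_normD (s - x) (x - c j.+1).
  by rewrite addrA subrK (distrC s x); lra.
have gms : gam s = g m s.
  apply: gam_stable => -[//|j]; rewrite ltnS => mj.
  by have := Hm j mj; have := hgt0 j; lra.
exists v; apply: chord_deriv_within => // e e0.
have e2 : 0 < e / 2 by lra.
have e4 : 0 < e / 4 by lra.
have [M0 hM0] := half_pow_small e4.
pose M := maxn m M0.
have mM : (m <= M)%N by exact: leq_maxl.
have hM : 2^-1 ^+ M < e / 4.
  by apply: le_lt_trans hM0; apply: half_pow_le; exact: leq_maxr.
have [del1 del10 Hd1] := deriv_within_chord dv e2.
(* The finitely many stages between [m] and [M] leave a neighbourhood of [s] unchanged. *)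
have [del2 del20 Hd2] : exists2 del2 : R, 0 < del2 &
    forall x, `|x - s| < del2 -> g M x = g m x.
  rewrite -(subnKC mM); elim: (M - m)%N => [|k [del del0 IH]].
    by exists 1 => // x _; rewrite addn0.
  exists (Num.min del (h (m + k).+1)); first by rewrite lt_min del0 hgt0.
  move=> x; rewrite lt_min addnS => /andP[xd xh].
  have [->|xs] := far (m + k)%N x (leq_addr _ _); first exact: IH.
  by have := lt_trans xh xs; rewrite ltxx.
exists (Num.min del1 del2); first by rewrite lt_min del10.
move=> x ux; rewrite lt_min => /andP[x1 x2].
have D : enorm (gam x - g m x) <= e / 2 * `|x - s|.
  rewrite -(Hd2 x x2); apply/ler_addgt0Pr => z z0.
  have [k Hk] := gam_lim x z0.
  have := Hk (maxn M k) (leq_maxr _ _).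
  have := @stage_dist x `|x - s| M.
  move=> /(_ _ (normr_ge0 _) (maxn M k) (leq_maxl _ _))-K1 K2.
  have {}K1 : enorm (g (maxn M k) x - g M x) <= 2 * `|x - s| * 2^-1 ^+ M.
    apply: K1 => j Mj.
    have [->|xs] := far j x (leq_trans mM Mj).
      by rewrite subrr enorm0 mulr_ge0// ltW// half_pow_gt0.
    apply: le_trans (rel_dist (fR j) x) _.
    by apply: ler_wpM2r; apply: ltW => //; exact: half_pow_gt0.
  have := enorm_trans (g (maxn M k) x) (gam x) (g M x).
  rewrite (enormB (gam x) (g (maxn M k) x)).
  by have := normr_ge0 (x - s); nra.
have := Hd1 x ux x1.
rewrite gms (_ : gam x - g m s - _ = (gam x - g m x) + (g m x - g m s - (x - s) *: v)).
  by move=> K; apply: le_trans (enormD _ _) _; lra.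
by apply/rowP => i; rewrite !mxE; ring.
Qed.

(** The unit directions of the pieces around [t] form a Cauchy sequence. All chords of each piece
    are close to its direction, so the limit direction is the derivative and has norm one. *)
Lemma gam_deriv_often t : inner_often t ->
  exists v, deriv_within (@unit_interval R) gam t v /\ enorm v = 1.
Proof.
move=> ht.
have /choice[i Hi] : forall n : nat, exists i, [/\ (0 < i)%N, `|t - c i| < tau i &
    nrad (f i) <= 2^-1 ^+ n].
  move=> n; have [[//|i]] := ht n; rewrite ltnS => ni ti; exists i.+1; split=> //.
  by apply: le_trans (rel_rad (fR i)) (half_pow_le ni).
have itv k : c (i k) - tau (i k) < t < c (i k) + tau (i k).
  by have [_ + _] := Hi k; rewrite ltr_distl.
have ut : unit_interval t.
  by have [_ /ltW/inner_itv ti _] := Hi 0%N; rewrite /unit_interval/=; lra.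
(* two directions attached to [t] differ by at most the sum of their radii, as
   both approximate the same chord from [t] *)
have close k l : enorm (ndir (f (i k)) - ndir (f (i l))) <= 2^-1 ^+ k + 2^-1 ^+ l.
  have Ik := itv k; have Il := itv l.
  pose x := Num.min (c (i k) + tau (i k)) (c (i l) + tau (i l)).
  have xt : t < x by rewrite lt_min; lra.
  have x1 : x <= c (i k) + tau (i k) by rewrite ge_min lexx.
  have x2 : x <= c (i l) + tau (i l) by rewrite ge_min lexx orbT.
  have Sk : enorm (gam x - gam t - (x - t) *: ndir (f (i k))) <=
      nrad (f (i k)) * `|x - t| by apply: (@gam_slopes (i k)); lra.
  have Sl : enorm (gam x - gam t - (x - t) *: ndir (f (i l))) <=
      nrad (f (i l)) * `|x - t| by apply: (@gam_slopes (i l)); lra.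
  have p0 : 0 < `|x - t| by rewrite normr_gt0 subr_eq0 gt_eqF.
  rewrite -(ler_pM2l p0) -enormZ.
  rewrite (_ : _ *: _ = (gam x - gam t - (x - t) *: ndir (f (i l)))
     - (gam x - gam t - (x - t) *: ndir (f (i k)))); last first.
    by apply/rowP => z; rewrite !mxE; ring.
  apply: le_trans (enormD _ _) _; rewrite enormN.
  have [_ _ rk] := Hi k; have [_ _ rl] := Hi l; nra.
have [v Hv] := enorm_cauchy close.
have small (e : R) : 0 < e -> exists k,
    nrad (f (i k)) <= e /\ enorm (ndir (f (i k)) - v) <= e.
  move=> e0; have d0 : 0 < d%:R + 1 :> R by rewrite ltr_wpDl.
  have [k hk] := half_pow_small (divr_gt0 e0 d0).
  have /ltW := hk; rewrite ler_pdivlMr// => hk'.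
  exists k; have [_ _ rk] := Hi k; have := Hv k; have := half_pow_gt0 k.
  have : 0 <= d%:R :> R by []; move: (d%:R : R) hk' => D; split; nra.
exists v; split.
  apply: chord_deriv_within => // e e0.
  have [|k [rk dk]] := small (e / 2); first lra.
  have Ik := itv k.
  exists (Num.min (t - (c (i k) - tau (i k))) (c (i k) + tau (i k) - t)).
    by rewrite lt_min; lra.
  move=> x ux; rewrite lt_min !ltr_distl => /andP[x1 x2].
  have S : slopes_in gam (c (i k) - tau (i k)) (c (i k) + tau (i k)) v e.
    by apply: slopes_in_ball (@gam_slopes (i k)); lra.
  by apply: S; lra.
apply/eqP; rewrite -subr_eq0 -normr_le0; apply/ler_addgt0Pr => e e0; rewrite add0r.
have [k [_ dk]] := small e e0.
have := enorm_dist v (ndir (f (i k))).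
by rewrite (inv_dir (fI (i k)) (leqnn _)) (enormB v); lra.
Qed.

(** Off [N], every derivative taken inside an inner interval around [t] lies in the slope ball of
    that piece, so two of them differ by at most twice its radius. *)
Lemma gam_osc_often t (dgam : R -> 'rV[R]_d) (N : set R) : inner_often t ->
  negl N ->
  (forall s, unit_interval s -> ~ N s ->
     deriv_within (@unit_interval R) gam s (dgam s)) ->
  forall e : R, 0 < e -> exists2 del : R, 0 < del & forall delta : R,
    0 < delta < del ->
    (osc dgam [set s | @unit_interval R s /\ (`|s - t| <= delta)%R] <= e%:E)%E.
Proof.
move=> ht nN dg e e0.
have [|n hn] := half_pow_small (e := e / 2); first lra.
have [[//|i]] := ht n; rewrite ltnS => ni ti.
have ri := le_trans (rel_rad (fR i)) (half_pow_le ni).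
exists (tau i.+1 - `|t - c i.+1|); first lra.
move=> delta dd; apply: ge_ereal_inf; eexists; first by exists N; [exact: nN|reflexivity].
apply: ge_ereal_sup => _ [s [[us st] Ns] [s' [[us' st'] Ns']] <-]; rewrite lee_fin.
have inJ x : `|x - t| <= delta -> c i.+1 - tau i.+1 < x < c i.+1 + tau i.+1.
  move=> xt; rewrite -ltr_distl.
  by have := ler_normD (x - t) (t - c i.+1); rewrite addrA subrK; lra.
have inU x : c i.+1 - tau i.+1 <= x <= c i.+1 + tau i.+1 -> unit_interval x.
  by rewrite -ler_distl => /inner_itv; rewrite /unit_interval/=; lra.
have H1 := deriv_within_slope (inJ s st) inU (@gam_slopes i.+1) (dg s us Ns).
have H2 := deriv_within_slope (inJ s' st') inU (@gam_slopes i.+1) (dg s' us' Ns').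
have := enorm_trans (ndir (f i.+1)) (dgam s) (dgam s').
by rewrite (enormB (ndir (f i.+1))); lra.
Qed.

Definition survivors i : set R := [set s | nset (f i) s /\
  forall j, (i < j)%N -> h j <= `|s - c j|].

(** The closed support of Lebesgue outer measure restricted to the union of all surviving sets. *)
Definition msupport : set R := [set s | forall q, qitv q s ->
  ~ negl (\bigcup_i survivors i `&` qitv q)].

Lemma survivors_posm i : ~ negl (survivors i).
Proof.
have [b0 bP] := inv_budget (fI i) (leqnn i).
apply: (posm_avoid bP b0 (P := fun j => (i < j)%N)) => j ij.
exact: (inv_out (fI j)).
Qed.

Lemma support_ae : negl (\bigcup_i survivors i `\` msupport).
Proof.
apply: negl_locally => s [Ss nFs].
have [q qs nq] : exists2 q, qitv q s & negl (\bigcup_i survivors i `&` qitv q).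
  apply: contrapT => H; apply: nFs => q qs nq; apply: H.
  by exists q.
by exists q => //; apply: negligibleS nq => x [[]].
Qed.

Lemma support_survivors i (A : set R) : ~ negl (survivors i `&` A) ->
  ~ negl (survivors i `&` A `&` msupport).
Proof.
move=> nA n; apply: nA; apply: negligibleS (negligibleU n support_ae) => s [Ss As].
by have [Fs|Fs] := pselect (msupport s); [left|right; split=> //; exists i].
Qed.

Lemma support_nonempty : msupport !=set0.
Proof.
have := @support_survivors 0%N setT; rewrite setIT => /(_ (@survivors_posm 0%N)).
by move=> /posm_nonempty[s [_ Fs]]; exists s.
Qed.

Lemma support_closed : closed msupport.
Proof.
rewrite -[msupport]setCK; apply: open_closedC.
rewrite openE => s nFs.
have [q qs nq] : exists2 q, qitv q s & negl (\bigcup_i survivors i `&` qitv q).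
  apply: contrapT => H; apply: nFs => q qs nq; apply: H.
  by exists q.
apply: (@filterS _ _ _ (qitv q)); first by move=> x qx Fx; exact: (Fx q).
apply: open_nbhs_nbhs; split=> //.
rewrite (_ : qitv _ = `]ratr q.1, ratr q.2[%classic); first exact: interval_open.
by apply/seteqP; split => x /=; rewrite in_itv.
Qed.

Lemma support_portion : every_portion_pos_measure msupport.
Proof.
move=> U oU [s [Us Fs]]; have [q qs qU] := open_qitv oU Us.
apply/lebesgue_gt0P => n; apply: (Fs q qs).
apply: negligibleS (negligibleU n support_ae) => x [Sx qx].
by have [Fx|Fx] := pselect (msupport x); [left; split=> //; exact: qU|right].
Qed.

Lemma support_itv : msupport `<=` @unit_interval R.
Proof.
move=> s Fs.
have K (e : R) : 0 < e -> `|s - c 0%N| <= tau 0%N + e.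
  move=> e0; have [q qs qe] := qitv_ball s e0.
  have [x [[i _ [nx _]] qx]] := posm_nonempty (Fs q qs).
  have := inv_root (fI i) (leqnn i) nx; have := qe x qx.
  by have := ler_normD (s - x) (x - c 0%N); rewrite addrA subrK (distrC s x); lra.
have /root_itv : `|s - c 0%N| <= tau 0%N by apply/ler_addgt0Pr.
by rewrite /unit_interval/=; lra.
Qed.

(** The open sets are the unions of the inner intervals of index above [n]. For density, a
    neighbourhood of a support point carries positive measure of some [survivors i]; the matching
    request recurs after stage [n], and the piece then inserted there contains support points of its
    own. *)
Lemma support_residual : residual_in msupport (inner_often `&` msupport).
Proof.
exists (fun n => (\bigcup_(i in [set i | (n < i)%N]) ball (c i) (tau i)) `&` msupport).
have inB i s : ball (c i) (tau i) s <-> `|s - c i| < tau i.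
  by rewrite /ball/= distrC.
split=> [n|].
  by exists (\bigcup_(i in [set i | (n < i)%N]) ball (c i) (tau i)) => //;
    apply: bigcup_open => i _; exact: ball_open.
split=> [n V oV [s [Vs Fs]]|s Hs].
  have [q qs qV] := open_qitv oV Vs.
  have [i ni] : exists i, ~ negl (survivors i `&` qitv q).
    apply: contrapT => H; apply: (Fs q qs); rewrite setI_bigcupl.
    apply: negligible_bigcup => i; apply: contrapT => ni.
    by apply: H; exists i.
  have [m mi cm] := code_inf (i, q) (maxn n i).
  have im : (i <= m)%N by apply: leq_trans mi; exact: leq_maxr.
  have nm : (n <= m)%N by apply: leq_trans mi; exact: leq_maxl.
  have fair := rel_fair (fR m); rewrite cm /= in fair.
  have {}fair := fair im (fun n' => ni (negligibleS _ n')).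
  have {}fair : forall x, `|x - c m.+1| <= tau m.+1 -> qitv q x.
    by apply: fair => x [[nx Hx] qx]; split=> //; split=> // j /andP[ij _]; exact: Hx.
  (* The survivors of the new piece have positive measure, so one of them belongs to the support. *)
  have := @support_survivors m.+1 setT; rewrite setIT => /(_ (@survivors_posm _)).
  move=> /posm_nonempty[x [[nx _] Fx]].
  have xm := inv_set (fI m.+1) (leqnn _) nx.
  exists x; split; first by apply/qV/fair/ltW.
  by split=> //; exists m.+1 => //; apply/inB.
split; last by have [] := Hs 0%N I.
by move=> n; have [[i /= ni /inB xi] _] := Hs n I; exists i.
Qed.

End Limit.

(** * The initial curve *)

Section Initial.
Context {R : realType} {d : nat}.
Local Notation mu := (@lebesgue_measure R).
Local Notation negl := (mu.-negligible).
Implicit Types (FF U : set 'rV[R]_d).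

(** Finite intersections make the sequence decreasing; density is kept because each open set meets
    every portion. *)
Lemma residual_portions FF (A : set 'rV[R]_d) : residual_in FF (A `&` FF) ->
  exists O : nat -> set 'rV[R]_d, [/\ forall n, open (O n),
    forall n U, portion FF U -> U `&` (O n `&` FF) !=set0,
    forall m n, (m <= n)%N -> O n `<=` O m &
    forall x, FF x -> (forall n, O n x) -> A x].
Proof.
move=> [G [Gop [Gdense GA]]].
have /choice[D1 HD1] : forall n, exists D1, open D1 /\ G n = D1 `&` FF.
  by move=> n; have [D1 oD1 E] := Gop n; exists D1.
pose O := fix O n : set 'rV[R]_d := if n is m.+1 then O m `&` D1 n else D1 0%N.
have OS n : O n.+1 = O n `&` D1 n.+1 by [].
have oO n : open (O n).
  by elim: n => [|n IH]; [case: (HD1 0%N)|rewrite OS; apply: openI => //; case: (HD1 n.+1)].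
have sub n : O n `<=` D1 n by case: n => [//|n] x [].
have D1d n U : portion FF U -> U `&` (D1 n `&` FF) !=set0.
  by move=> [oU UF]; have := Gdense n U oU UF; rewrite (HD1 n).2.
exists O; split=> //.
- elim=> [|n IH] U pU; first exact: D1d.
  have [x [Ux [Ox Fx]]] := IH U pU.
  have [|y [[Uy Oy] [D1y Fy]]] := D1d n.+1 (U `&` O n).
    by split; [apply: openI => //; case: pU|exists x].
  by exists y; split=> //; split=> //; rewrite OS.
- move=> m n mn; rewrite -(subnKC mn); elim: (n - m)%N => [|k IH]; first by rewrite addn0.
  by rewrite addnS OS; apply: subset_trans IH; exact: subIsetl.
- move=> x Fx Ox; have /GA[] // : (\bigcap_n G n) x.
  by move=> n _; rewrite (HD1 n).2; split=> //; exact: sub.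
Qed.

(** The Baire category argument with nested balls centred in [FF]; it will give a point of [FF]
    inside the open cube. *)
Lemma baire_point FF (O : nat -> set 'rV[R]_d) : closed FF -> FF !=set0 ->
  (forall n, open (O n)) ->
  (forall n U, portion FF U -> U `&` (O n `&` FF) !=set0) ->
  exists x, FF x /\ forall n, O n x.
Proof.
move=> cF [x0 Fx0] oO dO.
pose P n (xr : nat -> 'rV[R]_d * R) := FF (xr n).1 /\ 0 < (xr n).2.
pose Q n (xr : nat -> 'rV[R]_d * R) :=
  (forall y, enorm (y - (xr n.+1).1) <= (xr n.+1).2 ->
     O n y /\ enorm (y - (xr n).1) <= (xr n).2) /\ (xr n.+1).2 <= 2^-1 ^+ n.
have [xr H] : exists xr, forall n, P n xr /\ Q n xr.
  apply: history_choice.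
    by exists (x0, 1) => xr E; rewrite /P E.
  move=> n xr [Fx r0]; set x := (xr n).1 in Fx; set r := (xr n).2 in r0.
  have pB : portion FF [set y | enorm (y - x) < r].
    by split; [exact: open_eball|exists x; split=> //=; rewrite subrr enorm0].
  have [y [/= yx [Oy Fy]]] := dO n _ pB.
  have [e e0 He] := open_enorm (oO n) Oy.
  pose e' : R := Num.min (Num.min (e / 2) (r - enorm (y - x))) (2^-1 ^+ n).
  have e'0 : 0 < e' by rewrite !lt_min exprn_gt0// andbT; lra.
  have e'1 : e' <= e / 2 by rewrite !ge_min lexx.
  have e'2 : e' <= r - enorm (y - x) by rewrite !ge_min lexx orbT.
  have e'3 : e' <= 2^-1 ^+ n by rewrite !ge_min lexx !orbT.
  exists (y, e') => xr' E En; split; first by rewrite /P En.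
  split; rewrite En//= E// => z zy; split; first by apply: He; lra.
  by have := enorm_trans y z x; rewrite -/x -/r; lra.
have nest k n y : enorm (y - (xr (n + k)%N).1) <= (xr (n + k)%N).2 ->
    enorm (y - (xr n).1) <= (xr n).2.
  elim: k => [|k IH]; first by rewrite addn0.
  by rewrite addnS; have [_ [K _]] := H (n + k)%N; move=> /K[_ /IH].
have self n : enorm ((xr n).1 - (xr n).1) <= (xr n).2.
  by have [[_ /ltW]] := H n; rewrite subrr enorm0.
have nest' m n : (n <= m)%N -> enorm ((xr m).1 - (xr n).1) <= (xr n).2.
  by move=> nm; apply: (nest (m - n)%N); rewrite subnKC.
have [x Hx] : exists x, forall n, enorm ((xr n).1 - x) <= d%:R * (xr n).2.
  apply: (@enorm_cauchy _ _ (fun n => (xr n).1) (fun n => (xr n).2)) => k l.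
  have [[_ rk] _] := H k; have [[_ rl] _] := H l.
  have [kl|/ltnW lk] := leqP k l; first by rewrite enormB; have := nest' l k kl; lra.
  by have := nest' k l lk; lra.
have lim (e : R) n : 0 < e -> exists2 m, (n <= m)%N & enorm ((xr m).1 - x) < e.
  move=> e0; have d0 : 0 < d%:R + 1 :> R by rewrite ltr_wpDl.
  have [k hk] := half_pow_small (divr_gt0 e0 d0).
  exists (maxn n k).+1; first exact: leqW (leq_maxl _ _).
  have [_ [_ r1]] := H (maxn n k).
  have r2 := le_trans r1 (half_pow_le (leq_maxr n k)).
  have [[_ r0] _] := H (maxn n k).+1.
  move: hk; rewrite ltr_pdivlMr// => hk.
  apply: le_lt_trans (Hx _) _.
  have : 0 <= d%:R :> R by []; move: (d%:R : R) hk => D; nra.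
have inB n : enorm (x - (xr n).1) <= (xr n).2.
  apply/ler_addgt0Pr => e e0; have [m nm xm] := lim e n e0.
  have := enorm_trans (xr m).1 x (xr n).1; rewrite (enormB x (xr m).1).
  by have := nest' m n nm; lra.
exists x; split.
  apply: closed_enorm => // e e0; have [m _ xm] := lim e 0%N e0.
  by exists (xr m).1 => //; case: (H m) => -[].
by move=> n; have [_ [K _]] := H n; case: (K x (inB n.+1)).
Qed.

(** Unit vectors are at distance at most [2], so precision [3] imposes nothing on the tangents. *)
Lemma hereditary_pos_cone_width FF U u :
  every_portion_pos_cone_width FF -> enorm u = 1 -> hereditary FF U u 3.
Proof.
move=> FP u1 V [oV VF] _; have [nu [[nu' [h1 [h2 h3]]] pos]] := FP V oV VF.
exists nu, nu'; split=> // n; move/lebesgue_gt0P: pos; apply.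
apply: negligibleS n => s [us Vs]; split=> //; split=> //.
have := enormD (dirv (nu' s)) (- u); rewrite enormN u1 enorm_dirv ?h3//; lra.
Qed.

Lemma open_cube_open : open (@open_cube R d).
Proof.
apply: enorm_open => x Hx.
have [e e0 He] : exists2 e : R, 0 < e & forall i, e <= x ord0 i /\ e <= 1 - x ord0 i.
  exists (\big[Num.min/1]_(i < d) Num.min (x ord0 i) (1 - x ord0 i)).
    by apply: lt_bigmin => // i _; rewrite lt_min; have := Hx i; lra.
  move=> i; have : \big[Num.min/1]_(i < d) Num.min (x ord0 i) (1 - x ord0 i) <=
      Num.min (x ord0 i) (1 - x ord0 i) by apply: bigmin_le.
  by rewrite le_min => /andP.
exists e => // y yx i; have := enorm_coord (y - x) i; have := He i; rewrite !mxE.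
by have := Hx i; have := ler_norm (y ord0 i - x ord0 i);
  have := ler_norm (- (y ord0 i - x ord0 i)); rewrite normrN; lra.
Qed.

(** The piece recentred at [1/2] and continued on both sides with velocity [k *: u], where a small
    positive [k] bounds both the travel and the speed from the right side. *)
Definition extend (nu : R -> 'rV[R]_d) (tau k : R) (u : 'rV[R]_d) (s : R) : 'rV[R]_d :=
  nu (clamp 2^-1 tau s - 2^-1) + (k * (s - clamp 2^-1 tau s)) *: u.

Lemma extend_in nu tau k u s : `|s - 2^-1| <= tau ->
  extend nu tau k u s = nu (s - 2^-1).
Proof.
by move=> st; rewrite /extend clamp_id// subrr mulr0 scale0r addr0.
Qed.

Lemma extend_left nu tau k u s : 0 <= tau -> s <= 2^-1 - tau ->
  extend nu tau k u s = nu (- tau) + (k * (s - (2^-1 - tau))) *: u.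
Proof.
by move=> t0 st; rewrite /extend clamp_left// addrAC subrr sub0r.
Qed.

Lemma extend_right nu tau k u s : 0 <= tau -> 2^-1 + tau <= s ->
  extend nu tau k u s = nu tau + (k * (s - (2^-1 + tau))) *: u.
Proof.
by move=> t0 st; rewrite /extend clamp_right// addrAC subrr add0r.
Qed.

Lemma extend_slopes_left nu tau k u a : 0 <= tau ->
  slopes_in (extend nu tau k u) a (2^-1 - tau) (k *: u) 0.
Proof.
move=> t0 s t sa ta; rewrite !extend_left; [|lra..].
rewrite (_ : _ - _ = 0) ?enorm0 ?mul0r//.
by apply/rowP => i; rewrite !mxE; ring.
Qed.

Lemma extend_slopes_right nu tau k u b : 0 <= tau ->
  slopes_in (extend nu tau k u) (2^-1 + tau) b (k *: u) 0.
Proof.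
move=> t0 s t sa ta; rewrite !extend_right; [|lra..].
rewrite (_ : _ - _ = 0) ?enorm0 ?mul0r//.
by apply/rowP => i; rewrite !mxE; ring.
Qed.

Lemma extend_slopes_in nu tau k u w r : slopes_in nu (- tau) tau w r ->
  slopes_in (extend nu tau k u) (2^-1 - tau) (2^-1 + tau) w r.
Proof.
move=> H s t st tt; rewrite !extend_in ?ler_distl//; try lra.
have := H (s - 2^-1) (t - 2^-1).
by rewrite (_ : s - 2^-1 - (t - 2^-1) = s - t); [apply; lra|ring].
Qed.

Lemma slopes_in_deriv A (g : R -> 'rV[R]_d) (a b : R) w s : A s -> a < s < b ->
  slopes_in g a b w 0 -> deriv_within A g s w.
Proof.
move=> As sab H; apply: chord_deriv_within => // e e0.
exists (Num.min (s - a) (b - s)); first by rewrite lt_min; lra.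
move=> x _; rewrite lt_min !ltr_distl => /andP[x1 x2].
apply: le_trans (H x s _ _) _; [lra|lra|].
by rewrite mul0r mulr_ge0// ltW.
Qed.

Lemma extend_deriv nu (tau : R) k u s : 0 < tau -> unit_interval s ->
  (forall x, `|x| < tau -> exists v, deriv_within [set: R] nu x v) ->
  s != 2^-1 - tau -> s != 2^-1 + tau ->
  exists v, deriv_within (@unit_interval R) (extend nu tau k u) s v.
Proof.
move=> t0 us dn n1 n2.
have [s1|s1|/eqP] := ltgtP s (2^-1 - tau); last by rewrite (negbTE n1).
  exists (k *: u).
  apply: (@slopes_in_deriv _ _ (s - 1) (2^-1 - tau)) => //; first lra.
  by apply: extend_slopes_left; lra.
have [s2|s2|/eqP] := ltgtP s (2^-1 + tau); last by rewrite (negbTE n2).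
  have st : `|s - 2^-1| < tau by rewrite ltr_distl; lra.
  have [v dv] := dn _ st.
  exists (1 *: v).
  apply: (@deriv_within_near _ _ _ [set: R] (fun y => nu (1 * y - 2^-1)) _ s _
    (tau - `|s - 2^-1|)) => //.
  - by lra.
  - move=> x ux xs; split=> //; rewrite mul1r extend_in//.
    have := ler_normD (x - s) (s - 2^-1); rewrite addrA subrK; lra.
  - apply: (@deriv_within_affine _ _ [set: R]) => //; first by exists 1.
    by rewrite mul1r.
exists (k *: u).
apply: (@slopes_in_deriv _ _ (2^-1 + tau) (s + 1)) => //; first lra.
by apply: extend_slopes_right; lra.
Qed.

Lemma initial_node FF (U0 : set 'rV[R]_d) :
  every_portion_pos_cone_width FF -> portion FF U0 -> (0 < d)%N ->
  exists (x : @node R d) (k : R), [/\ forall f, f 0%N = x -> stage_inv FF 0 f,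
    0 < k, nrad x <= 2^-1,
    slopes_in (ncur x) 0 (ncen x - nin x) (k *: ndir x) 0 /\
    slopes_in (ncur x) (ncen x + nin x) 1 (k *: ndir x) 0 &
    (forall s, 0 <= s <= 1 -> U0 (ncur x s)) /\
    forall y, enorm (y - ncur x (ncen x - nin x)) <= 2 * nin x -> U0 y].
Proof.
move=> FP [oU0 [y0 [Uy0 Fy0]]] d0.
have [rho rho0 Hrho] := open_enorm oU0 Uy0.
pose u0 : 'rV[R]_d := delta_mx ord0 (Ordinal d0).
have u01 : enorm u0 = 1.
  rewrite /enorm (bigD1 (Ordinal d0))//= big1 ?addr0 => [|i ni].
    by rewrite mxE !eqxx expr1n sqrtr1.
  by rewrite mxE (negbTE ni) andbF expr0n.
have rho2 : 0 < rho / 2 by lra.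
have pV : portion FF [set y | enorm (y - y0) < rho / 2].
  by split; [exact: open_eball|exists y0; split=> //=; rewrite subrr enorm0].
(* The radius [8 / 16 = 1 / 2] keeps the speed on the initial piece at least [1 / 2]. *)
have e0 : 0 < 16^-1 :> R by [].
have [U [u [pU UV u1 _ hU]]] :=
  hereditary_refine pV (hereditary_pos_cone_width (U := _) FP u01) e0.
pose tau0 : R := Num.min 4^-1 (rho / 16).
have tau00 : 0 < tau0 by rewrite lt_min; lra.
have [tau [nu [sg [/andP[tp tauP] sg0 sn1 sn2 [nN dn]]]]] :=
  hits_piece e0 tau00 u1 (hU _ pU (fun _ H => H)).
have t1 : tau <= 4^-1 by apply: le_trans tauP _; rewrite ge_min lexx.
have t2 : tau <= rho / 16 by apply: le_trans tauP _; rewrite ge_min lexx orbT.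
have tp' := ltW tp.
have [x1 [x1t [Ux1 Fx1]]] := posm_nonempty nN.
have x1d : enorm (nu x1 - y0) < rho / 2 by exact: UV.
have [sg' [s1 s2 s3]] : exists sg' : R, [/\ sg' <= sg, sg' <= 2^-1 & 0 < sg'].
  by exists (Num.min sg 2^-1); rewrite lt_min !ge_min !lexx orbT sg0; split=> //; lra.
(* The first bound is for the Lipschitz constant, the second keeps the affine ends close to [y0]. *)
have [k [k0 k1 k2]] : exists k : R, [/\ 0 < k, k <= 1 - sg' & k <= rho / 16].
  exists (Num.min (1 - sg') (rho / 16)).
  by rewrite lt_min !ge_min !lexx orbT; split=> //; lra.
pose G := extend nu tau k u.
pose S := [set s | `|s - 2^-1| < tau /\ (U `&` FF) (nu (s - 2^-1))].
have nS : ~ negl S.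
  move=> nS; apply: nN; apply: negligibleS (negl_affine 2^-1 ltr01 nS) => s Us.
  by rewrite /S/= mul1r addrK.
have [b b0 bP] := posm_budget nS.
have G0 : slopes_in G 0 1 0 (1 - sg').
  apply: (@slopes_in_glue _ _ _ _ (2^-1 - tau)).
    apply: slopes_in_ball (@extend_slopes_left nu tau k u 0 tp').
    by rewrite subr0 enormZ u1 gtr0_norm//; lra.
  apply: (@slopes_in_glue _ _ _ _ (2^-1 + tau)).
    by apply: slopes_in_le (@extend_slopes_in nu tau k u _ _ sn2); lra.
  apply: slopes_in_ball (@extend_slopes_right nu tau k u 1 tp').
  by rewrite subr0 enormZ u1 gtr0_norm//; lra.
have G1 : slopes_in G (2^-1 - tau) (2^-1 + tau) u (8 * 16^-1 - sg').
  by apply: slopes_in_le (@extend_slopes_in nu tau k u _ _ sn1); lra.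
have near_y0 x : - tau <= x <= tau -> enorm (nu x - y0) < rho * (5 / 8).
  move=> xt; have sn3 : slopes_in nu (- tau) tau 0 1 by apply: slopes_in_le sn2; lra.
  have H := (@slopes_in0 _ _ nu (- tau) tau 1).2 sn3 x x1.
  have {}H : enorm (nu x - nu x1) <= 1 * `|x - x1|.
    by apply: H => //; move: x1t; rewrite ltr_norml; lra.
  have := ler_normB x x1; have : `|x| <= tau by rewrite ler_norml.
  by have := enorm_trans (nu x1) (nu x) y0; lra.
have GU s : 0 <= s <= 1 -> enorm (G s - y0) < rho * (3 / 4).
  move=> s01.
  have sc : `|s - clamp 2^-1 tau s| <= 1.
    have := clamp_dist 2^-1 s tp'; rewrite ler_distl => cd.
    by rewrite ler_distl; lra.
  have cn : - tau <= clamp 2^-1 tau s - 2^-1 <= tau.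
    by have := clamp_dist 2^-1 s tp'; rewrite ler_norml.
  have Gd : enorm (G s - nu (clamp 2^-1 tau s - 2^-1)) <= k.
    rewrite /G /extend addrAC subrr add0r enormZ u1 mulr1 normrM gtr0_norm//.
    by rewrite ler_piMr// ltW.
  have := enorm_trans (nu (clamp 2^-1 tau s - 2^-1)) (G s) y0.
  by have := near_y0 _ cn; lra.
exists (Node G 2^-1 tau 1 u 2^-1 U S b), k; split=> //.
- move=> f f0; split.
  + exists sg'; rewrite f0; split=> // i; rewrite leqn0 => /eqP ->; rewrite f0 /=.
    by rewrite (_ : 2^-1 - sg' = 8 * 16^-1 - sg')//; congr (_ - _); field.
  + move=> i; rewrite leqn0 => /eqP ->; rewrite f0 /=; split=> //.
      by case: pU.
    by rewrite (_ : 2^-1 / 8 = 16^-1 :> R)//; field.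
  + by move=> i; rewrite leqn0 => /eqP ->; rewrite f0.
  + by move=> i; rewrite leqn0 => /eqP ->; rewrite f0.
  + by move=> i; rewrite leqn0 => /eqP ->; rewrite f0 => s [].
  + move=> i; rewrite leqn0 => /eqP -> s [+ _]; rewrite f0 /= => -[st Us].
    by rewrite /G extend_in// ltW.
  + move=> i j; rewrite !leqn0 => /eqP -> /eqP -> s _ _.
    by rewrite subrr enorm0 add0r.
  + by move=> i; rewrite leqn0 => /eqP -> s; rewrite f0 => -[].
  + by rewrite f0 /=; split; lra.
  + by move=> i j ij; rewrite leqn0 => /eqP j0; rewrite j0 ltn0 in ij.
  + rewrite f0 /=; apply: negligibleS (negligibleU (negl_point (2^-1 - tau))
      (negl_point (2^-1 + tau))) => s [us nd].
    apply: contrapT => /not_orP[/eqP n1 /eqP n2]; apply: nd.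
    exact: extend_deriv.
- by split; [exact: extend_slopes_left|exact: extend_slopes_right].
- split=> [s s01|y /= yG]; apply: Hrho; first by have /= := GU s s01; lra.
  have e1 : G (2^-1 - tau) = nu (- tau).
    by rewrite /G extend_in addrAC subrr sub0r// normrN gtr0_norm.
  rewrite e1 in yG; have := near_y0 (- tau) ltac:(lra).
  by have := enorm_trans (nu (- tau)) y y0; lra.
Qed.

End Initial.

(** * Recurrent requests and the final assembly *)

Lemma inj_unbounded (f : nat -> nat) : injective f -> forall n, exists k, (n <= f k)%N.
Proof.
move=> f_inj n; apply: contrapT => H.
have lt_fn k : (f k < n)%N by rewrite ltnNge; apply/negP => nk; apply: H; exists k.
pose g (k : 'I_n.+1) : 'I_n := Ordinal (lt_fn k).
have g_inj : injective g by move=> i j [/f_inj/val_inj].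
by have := leq_card g g_inj; rewrite !card_ord ltnn.
Qed.

(** Decode pairs [(x, k)] and forget [k]: the codes of the pairs with given [x] are unbounded.
    Numbers that are not codes get the default [x0]. *)
Lemma recurrent_enumeration (T : countType) (x0 : T) :
  exists code : nat -> T, forall x n, exists2 m, (n <= m)%N & code m = x.
Proof.
exists (fun n => if unpickle n is Some xk then (xk : T * nat).1 else x0) => x n.
have inj : injective (fun k : nat => pickle (x, k)).
  by move=> k l /(pcan_inj pickleK)[].
have [k nk] := inj_unbounded inj n.
by exists (pickle (x, k)); [exact: nk|rewrite pickleK].
Qed.

Unset Implicit Arguments.

Theorem theorem2p11 (R : realType) (d : nat) (hd : (0 < d)%N)
    (FF AA : set 'rV[R]_d) :
  FF !=set0 -> closed FF -> FF `<=` @closed_cube R d ->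
  every_portion_pos_cone_width FF ->
  AA `<=` @open_cube R d -> analytic AA ->
  residual_in FF (AA `&` FF) ->
  exists (gamma gamma' : R -> 'rV[R]_d) (E F : set R),
    lipschitz1_curve gamma gamma' /\
        gamma @` @unit_interval R `<=` @open_cube R d /\
        E `<=` F /\ F `<=` @unit_interval R /\
        (* (i) *) F !=set0 /\ closed F /\ every_portion_pos_measure F /\
        (* (ii) *) residual_in F E /\
        (* (iii) *) (forall t, E t -> exists v : 'rV[R]_d,
                       deriv_within (@unit_interval R) gamma t v /\ enorm v = 1) /\
        (* (iv) *) (forall t, E t -> forall e : R, 0 < e ->
                      exists2 del : R, 0 < del & forall delta : R,
                        0 < delta < del ->
                        (osc gamma' [set s | @unit_interval R s /\
                                             (`|s - t| <= delta)%R] <= e%:E)%E) /\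
        (* (v) *) gamma @` E `<=` AA.
Proof.
move=> FF0 FFc _ FFp AAsub _ res.
have [Om [oO dO decO OA]] := residual_portions res.
have [x0 [Fx0 Ox0]] := baire_point FFc FF0 oO dO.
have pU0 : portion FF (@open_cube R d).
  by split; [exact: open_cube_open|exists x0; split=> //; exact/AAsub/OA].
have [x [k [init k0 rad [slL slR] [cube0 cube1]]]] := initial_node FFp pU0 hd.
have [code codeP] := recurrent_enumeration (0%N, (0%:Q, 0%:Q)).
have [f Hf] : exists f, forall n, (stage_inv FF n f /\ f 0%N = x) /\
    stage_rel FF Om code n f.
  apply: (@history_choice _ (fun n f => stage_inv FF n f /\ f 0%N = x)).
    by exists x => f f0; split=> //; exact: init.
  move=> n f [If f0]; have [y Hy] := step code oO dO If; exists y => f' fE fy.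
  by have [I' R'] := Hy f' fE fy; split=> //; split=> //; rewrite fE.
have fI n : stage_inv FF n f by case: (Hf n) => -[].
have fR n : stage_rel FF Om code n f by case: (Hf n).
have f0 : f 0%N = x by case: (Hf 0%N) => -[].
have [gam gam_lim] := limit_curve fR.
(* All later outer intervals lie inside the root interval, so the affine ends are never changed. *)
have out s : nin x <= `|s - ncen x| -> gam s = ncur x s.
  rewrite -f0 => sx; apply: (gam_stable fR gam_lim) => -[//|j] _.
  by rewrite leNgt; apply/negP => /(outer_root fR); rewrite ltNge sx.
(* The derivative function takes the default value [0] where no derivative exists. *)
have /choice[dgam Hdg] : forall s, exists v,
    (exists w, deriv_within (@unit_interval R) gam s w) ->
    deriv_within (@unit_interval R) gam s v.
  move=> s; have [[w dw]|H] := pselect (exists w, deriv_within (@unit_interval R) gam s w).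
    by exists w.
  by exists 0 => /H.
pose P2 (a b : R) : set R := [set a] `|` [set b].
have nP (a b : R) : (@lebesgue_measure R).-negligible (P2 a b).
  by apply: negligibleU; exact: negl_point.
have nN := negligibleU (gam_deriv_ae fI fR gam_lim) (negligibleU (nP 0 1)
  (nP (ncen x - nin x) (ncen x + nin x))).
set N := _ `|` _ in nN.
have dg s : unit_interval s -> ~ N s ->
    deriv_within (@unit_interval R) gam s (dgam s).
  move=> us Ns; apply: Hdg; apply: contrapT => H; apply: Ns; left.
  by split.
have lip := (@slopes_in0 _ _ gam 0 1 1).2 (gam_lipschitz fI gam_lim).
have [i0 i1] := inv_itv (fI 0%N); rewrite f0 in i0 i1.
have t0 := tau_gt0 fI 0%N; rewrite f0 in t0.
exists gam, dgam, (inner_often f `&` msupport f), (msupport f).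
split; last split; last split; last split; last split; last split;
  last split; last split; last split; last split.
- split=> [s t us ut|]; first by rewrite -[`|s - t|]mul1r; exact: lip.
  (* The speed is at least [k] on the affine ends and at least [1 - 1/2] on the root interval, whose
     slopes lie in a ball of radius at most [1/2] around a unit vector. *)
  exists (Num.min k 2^-1); first by rewrite lt_min k0 invr_gt0 ltr0n.
  exists N; split=> // s us Ns; split; first exact: dg.
  have u1 := inv_dir (fI 0%N) (leqnn _); rewrite f0 in u1.
  have [us0 us1] : 0 < s /\ s < 1.
    have [n0 n1] : s <> 0 /\ s <> 1.
      by split=> E; apply: Ns; right; left; [left|right].
    by move: us => /andP[]; rewrite !le_eqVlt => /orP[/eqP/esym//|->] /orP[/eqP//|->].
  have bound (a b : R) w r : 0 <= a -> b <= 1 -> a < s < b -> slopes_in gam a b w r ->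
      enorm w - r <= enorm (dgam s).
    move=> a0 b1 sab sl.
    have abU y : a <= y <= b -> unit_interval y by rewrite /unit_interval/=; lra.
    have := deriv_within_slope sab abU sl (dg s us Ns).
    have := enorm_dist (dgam s) w; rewrite ler_norml; lra.
  have lek : Num.min k 2^-1 <= k by rewrite ge_min lexx.
  have leh : Num.min k 2^-1 <= 2^-1 by rewrite ge_min lexx orbT.
  have [s1|s1|s1] := ltgtP s (ncen x - nin x); last first.
  + by exfalso; apply: Ns; right; right; left.
  + have [s2|s2|s2] := ltgtP s (ncen x + nin x); last first.
    * by exfalso; apply: Ns; right; right; right.
    * have sl : slopes_in gam (ncen x + nin x) 1 (k *: ndir x) 0.
        apply: slopes_in_eq slR => y yx; apply/esym/out.
        by rewrite ger0_norm; lra.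
      have := bound _ _ _ _ _ _ _ sl.
      rewrite enormZ u1 gtr0_norm// => /(_ ltac:(lra) ltac:(lra) ltac:(lra)); lra.
    * have := gam_slopes fI gam_lim (i := 0%N); rewrite f0 => sl.
      have := bound _ _ _ _ _ _ _ sl.
      rewrite u1 => /(_ ltac:(lra) ltac:(lra) ltac:(lra)); lra.
  + have sl : slopes_in gam 0 (ncen x - nin x) (k *: ndir x) 0.
      apply: slopes_in_eq slL => y yx; apply/esym/out.
      by rewrite ler0_norm; lra.
    have := bound _ _ _ _ _ _ _ sl.
    rewrite enormZ u1 gtr0_norm// => /(_ ltac:(lra) ltac:(lra) ltac:(lra)); lra.
- move=> _ [s us <-]; have [sx|sx] := leP (nin x) `|s - ncen x|.
    by rewrite out//; exact: cube0.
  apply: cube1.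
  have := gam_inner fI fR gam_lim (i := 0%N) (s := s); rewrite f0.
  by apply; exact: ltW.
- by move=> s [].
- exact: (support_itv fI).
- exact: (support_nonempty fI).
- exact: support_closed.
- exact: support_portion.
- exact: (support_residual fI fR codeP).
- by move=> t [ht _]; exact: (gam_deriv_often fI fR gam_lim).
- move=> t [ht _] e e0; exact: (gam_osc_often fI fR gam_lim ht nN dg).
- move=> _ [t [ht _] <-].
  have [Ft Ot] := gam_often fI fR FFc decO gam_lim ht.
  exact: OA.
Qed.
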